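(* The multicast capacity of a linear finite-field symmetric network with interference on $\mathcal G=(V,E)$ with source $s=1$ and destination set $D$ equals $$\min_{S\in\Gamma}\sum_{v\in\bar S^c}C_v,$$ where $C_v$ is the capacity of the symmetric discrete memoryless channel $(\mathbb F_{q_v},p(y_v|x_v),\mathcal Y_v)$ at node $v$.
   Context: $\mathcal G=(V,E)$ is a directed graph, $V=\{1,\dots,|V|\}$; node $1$ is the source $s$ (no incoming edges); $D\subseteq V\setminus\{1\}$ are destinations (no outgoing edges); $\Delta(v)=\{u:(u,v)\in E\}$. The network: each node $v\neq1$ has a finite field $\mathbb F_{q_v}$ (field sizes may differ across nodes); for each edge $(u,v)$ node $u$ sends a separate symbol $X_{u,v}^{(t)}\in\mathbb F_{q_v}$ at time $t$ (outgoing channels are orthogonal); node $v$ receives $Y_v^{(t)}$, the output of a memoryless symmetric DMC $(\mathbb F_{q_v},p(y_v|x_v),\mathcal Y_v)$ with input $X_v^{(t)}=\sum_{u\in\Delta(v)}\beta_{u,v}X_{u,v}^{(t)}$, where $\beta_{u,v}\in\mathbb F_{q_v}\setminus\{0\}$ are fixed coefficients; the channels at different nodes act independently. A DMC is symmetric (in Gallager's sense) if its output alphabet can be partitioned into subsets such that, for each subset, in the submatrix of transition probabilities (rows indexed by inputs, columns by outputs in the subset) every row is a permutation of every other row and every column is a permutation of every other column. A code of length $N$: message $W$ uniform on $\{1,\dots,M\}$; $X_{s,w}^{(t)}=f^{(t)}_{s,w}(W)$; relays $X_{v,w}^{(t)}=f^{(t)}_{v,w}(Y_v^{(1)},\dots,Y_v^{(t-1)})$;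 decoders $g_d(Y_d^{(1)},\dots,Y_d^{(N)})$, $d\in D$; $P_e=\Pr\{\bigcup_{d\in D}\{g_d\neq W\}\}$. Rate $R$ is achievable if for every $\epsilon>0$ and all large $N$ there are codes with $M\ge2^{NR}$ and $P_e\le\epsilon$; the multicast capacity is the supremum of achievable rates (capacities in bits). A cut is $S\subset V$ with $s\in S$ and $S^c\cap D\neq\emptyset$; $\Gamma$ is the set of cuts; $\bar S^c=\{v\in S^c:\exists u\in S,(u,v)\in E\}$. *)

(* Defs.v *)
From HB Require Import structures.
From mathcomp Require Import all_boot all_order all_algebra all_fingroup.
From mathcomp Require Import finalg.
From mathcomp Require Import classical_sets reals exp.
Set Implicit Arguments. Unset Strict Implicit. Unset Printing Implicit Defensive.
Import Order.TTheory GRing.Theory Num.Theory.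
Local Open Scope ring_scope.

(* The node set V is [option 'I_n]: the source s (node 1 of the paper) *)
(* is [None], the other |V|-1 nodes are [Some v], v : 'I_n.            *)

Definition node (n : nat) := option 'I_n.

Section Information.
Variable R : realType.

Definition log2 (x : R) : R := ln x / ln 2.

Definition is_dmc (X Y : finType) (W : X -> Y -> R) : Prop :=
  (forall x y, 0 <= W x y) /\ (forall x, \sum_(y : Y) W x y = 1).

Definition gallager_symmetric (X Y : finType) (W : X -> Y -> R) : Prop :=
  exists P : {set {set Y}}, finset.partition P (finset.setTfor Y) /\
    forall B, B \in P ->
      (forall x x', exists sigma : {perm Y},
          forall y, y \in B -> (sigma y \in B) /\ W x' y = W x (sigma y)) /\
      (forall y y', y \in B -> y' \in B -> exists pi : {perm X},
          forall x, W x y' = W (pi x) y).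

Definition is_distr (X : finType) (p : X -> R) : Prop :=
  (forall x, 0 <= p x) /\ \sum_(x : X) p x = 1.

Definition mutual_info (X Y : finType) (p : X -> R) (W : X -> Y -> R) : R :=
  \sum_(x : X) \sum_(y : Y)
     (if p x * W x y == 0 then 0
      else p x * W x y * log2 (W x y / \sum_(x' : X) p x' * W x' y)).

Definition capacity (X Y : finType) (W : X -> Y -> R) : R :=
  sup [set z | exists p : X -> R, is_distr p /\ z = mutual_info p W].

End Information.

Section Network.
Variable R : realType.
Variable n : nat.
Variable F : 'I_n -> finFieldType.
Variable Y : 'I_n -> finType.
Variable W : forall v : 'I_n, F v -> Y v -> R.
Variable e : rel (node n).
Variable beta : forall (u : node n) (v : 'I_n), F v.
Variable D : {set 'I_n}.

(* A code of length N with M messages (messages are 'I_M).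
   [src v t m]     : X_{s,v}^{(t)} = f_{s,v}^{(t)}(W)
   [rly u v t y]   : X_{u,v}^{(t)} = f_{u,v}^{(t)}(Y_u^{(1)},...,Y_u^{(t-1)}),
                     given as a function of the whole output sequence of u
                     that depends only on the entries at times < t;
   [dec d y]       : g_d(Y_d^{(1)},...,Y_d^{(N)}).
   Values at non-edges are irrelevant. *)
Record code (N M : nat) := Code {
  src : forall v : 'I_n, 'I_N -> 'I_M -> F v;
  rly : forall (u v : 'I_n), 'I_N -> {ffun 'I_N -> Y u} -> F v;
  rly_causal : forall (u v : 'I_n) (t : 'I_N) (y y' : {ffun 'I_N -> Y u}),
      (forall i : 'I_N, (i < t)%N -> y i = y' i) -> rly v t y = rly v t y';
  dec : forall d : 'I_n, {ffun 'I_N -> Y d} -> 'I_M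
}.

Definition traj (N : nat) := {dffun forall v : 'I_n, {ffun 'I_N -> Y v}}.

Definition chan_in N M (c : code N M) (v : 'I_n) (t : 'I_N) (m : 'I_M)
    (y : traj N) : F v :=
  \sum_(u : node n | e u (Some v))
     beta u v * (match u with
                 | None => src c v t m
                 | Some u' => @rly N M c u' v t (y u')
                 end).

(* joint probability of the output trajectory given message m
   (memoryless channels acting independently at the nodes) *)
Definition traj_prob N M (c : code N M) (m : 'I_M) (y : traj N) : R :=
  \prod_(v : 'I_n) \prod_(t : 'I_N) W (chan_in c v t m y) (y v t).

Definition err_prob N M (c : code N M) : R :=
  M%:R^-1 * \sum_(m : 'I_M) \sum_(y : traj N)
     (if [exists d in D, dec c (y d) != m] then traj_prob c m y else 0).

Definition achievable (r : R) : Prop :=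
  forall eps : R, 0 < eps -> exists N0 : nat, forall N : nat, (N0 <= N)%N ->
    exists M : nat, exists c : code N M,
      (2 : R) `^ (N%:R * r) <= M%:R /\ err_prob c <= eps.

Definition multicast_capacity : R := sup [set r | achievable r].

Definition is_cut (S : {set node n}) : bool :=
  (None \in S) && [exists d in D, Some d \notin S].

Definition cut_boundary (S : {set node n}) : {set 'I_n} :=
  [set v : 'I_n | (Some v \notin S) && [exists u in S, e u (Some v)]].

Definition cut_value (S : {set node n}) : R :=
  \sum_(v in cut_boundary S) capacity (@W v).

(* min over the (finite, nonempty) set of cuts *)
Definition min_cut : R :=
  inf [set z | exists S : {set node n}, is_cut S /\ z = cut_value S].

End Network.

(* Main.v *)
(* Converse.  For a cut [S], compare the true law with the one where every
   node of the boundary receives i.i.d. symbols drawn from the output law of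
   the uniform input.  Under the second law the outputs on the far side of the
   cut do not depend on the message.  By Gallager symmetry the moments of the
   information density do not depend on the channel input, so the likelihood
   ratio concentrates, whatever the relays do, at [N] times the cut value; a
   change of measure then gives a strong converse.

   Achievability.  Time is cut into [B] blocks of length [L].  All in-neighbours
   of [v] use one affine code [x |-> x G + a] over [F v], so that [v] decodes the
   linear combination of their messages at a rate close to its capacity.
   Each node maps everything decoded so far to its next messages by a random
   function.  For two messages, let [S] be the set of relays that can tell them
   apart and [a] the largest probability that a cut blocks new information.
   The potential [a ^ #|S|], restricted to the event that a destination is not
   in [S], shrinks on average by the factor [2 a] per block; choosing the maps
   block by block derandomizes this together with the decoding errors. *)
Require Import Defs.
From HB Require Import structures.
From mathcomp Require Import all_boot all_order all_algebra all_fingroup.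
From mathcomp Require Import finalg.
From mathcomp Require Import classical_sets reals exp.
From mathcomp Require Import boolp sequences ring lra.
Import Order.TTheory GRing.Theory Num.Theory.
Local Open Scope ring_scope.

Set Implicit Arguments.
Unset Strict Implicit.
Unset Printing Implicit Defensive.

(** * Elementary estimates, averaging and counting *)

Section RealLemmas.
Variable R : realType.
Implicit Types (x u : R).

Lemma ln_le_subr1 x : 0 < x -> ln x <= x - 1.
Proof. by move=> x0; have := expR_ge1Dx (ln x); rewrite lnK ?posrE//; lra. Qed.

Lemma ln2_gt0 : 0 < ln 2 :> R.
Proof. by apply: ln_gt0; rewrite ltr1n. Qed.

(** From [exp (- u) >= 1 - u] one gets [exp u <= 1 / (1 - u)], and [(1 + u + 2 u^2) (1 - u) = 1 +
    u^2 (1 - 2 u)] is at least 1 for [u <= 1 / 2]. *)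
Lemma expR_le_quadratic u : u <= 1 / 2 -> expR u <= 1 + u + 2 * u ^+ 2.
Proof.
move=> hu; have h := expR_ge1Dx (- u).
rewrite expRN in h; have e0 := expR_gt0 u.
have h1 : (1 - u) * expR u <= 1.
  by rewrite -ler_pdivlMr// div1r.
apply: (@le_trans _ _ (1 - u)^-1).
  by rewrite -[leRHS]mul1r ler_pdivlMr; [rewrite mulrC|lra].
rewrite -[leLHS]mul1r ler_pdivrMr; last lra.
nra.
Qed.

Lemma expR_decay (A k eps : R) : 0 < k -> 0 < eps ->
  exists L0 : nat, forall L, (L0 <= L)%N -> expR (A - L%:R * k) <= eps.
Proof.
move=> k0 e0; exists (Num.truncn ((A - ln eps) / k)).+1 => L hL.
rewrite -[leRHS]lnK ?posrE// ler_expR.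
have : (A - ln eps) / k <= L%:R.
  by apply: ltW; apply: lt_le_trans (truncnS_gt _) _; rewrite ler_nat.
rewrite ler_pdivrMr// => h; lra.
Qed.

Lemma common_pos (I : finType) (P : I -> R -> Prop) :
  (forall i, exists2 s1, 0 < s1 & forall s, 0 < s <= s1 -> P i s) ->
  exists2 s, 0 < s & forall i, P i s.
Proof.
move=> h.
have [f hf] := @fin_all_exists I (fun=> R)
  (fun i s1 => 0 < s1 /\ forall s, 0 < s <= s1 -> P i s)
  (fun i => let: ex_intro2 s a b := h i in ex_intro _ s (conj a b)).
suff [s s0 hs] : exists2 s, 0 < s & forall i, s <= f i.
  by exists s => // i; apply: (hf i).2; rewrite s0 hs.
(* Factors in (0, 1] make the product a positive lower bound for every [f i], also over an empty
   index type. *)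
exists (\prod_i Num.min 1 (f i)).
  by apply: prodr_gt0 => i _; rewrite lt_min ltr01 (hf i).1.
move=> i; rewrite (bigD1 i)//=.
have m0 : 0 <= Num.min 1 (f i) by rewrite le_min ler01 ltW// (hf i).1.
apply: (@le_trans _ _ (Num.min 1 (f i))); last by rewrite ge_min lexx orbT.
apply: ler_piMr => //.
rewrite -[leRHS](@big1_eq R 1 *%R _ (index_enum I) (fun j => j != i)).
apply: ler_prod => j _; rewrite le_min ler01 ltW ?(hf j).1//=.
by rewrite ge_min lexx.
Qed.

Lemma common_nat (I : finType) (P : I -> nat -> Prop) :
  (forall i, exists L0, forall L, (L0 <= L)%N -> P i L) ->
  exists L0, forall L, (L0 <= L)%N -> forall i, P i L.
Proof.
move=> h; have [f hf] := @fin_all_exists I (fun=> nat) _ h.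
exists (\max_i f i) => L hL i; apply: hf; apply: leq_trans hL.
exact: leq_bigmax.
Qed.

Lemma exists_le_average (I : finType) (f : I -> R) (c : R) :
  (0 < #|I|)%N -> \sum_i f i <= #|I|%:R * c -> exists i, f i <= c.
Proof.
move=> I0 h; apply: contrapT => /forallNP hn.
have : \sum_(i : I) c < \sum_i f i.
  have /card_gt0P[i0 _] := I0.
  rewrite (bigD1 i0)//= [ltRHS](bigD1 i0)//=; apply: ltr_leD.
    by rewrite ltNge; apply/negP/hn.
  by apply: ler_sum => i _; rewrite ltW// ltNge; apply/negP/hn.
by rewrite sumr_const -mulr_natl => /lt_le_trans/(_ h); rewrite ltxx.
Qed.

(** The injections force all fibres of [phi] to have the same size, so [phi] carries the uniform law
    to the uniform law. Uniformity of random codewords is proved below by such shifts of the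
    randomness. *)
Lemma sum_equal_fibers (A B : finType) (phi : A -> B) (h : B -> R) :
  (forall b b', exists2 s : A -> A, injective s &
     forall a, phi a = b -> phi (s a) = b') ->
  #|B|%:R * \sum_a h (phi a) = #|A|%:R * \sum_b h b.
Proof.
move=> hs; pose N b := #|[set a | phi a == b]|.
have Nle b b' : (N b <= N b')%N.
  have [s sinj hsb] := hs b b'; rewrite /N -(card_imset _ sinj).
  apply: subset_leq_card; apply/fintype.subsetP => _ /imsetP[a + ->].
  by rewrite !inE => /eqP/hsb ->.
have sumE (g : B -> R) : \sum_a g (phi a) = \sum_b (N b)%:R * g b.
  rewrite (partition_big phi predT)//=; apply: eq_bigr => b _.
  rewrite (eq_bigr (fun=> g b)); last by move=> a /eqP ->.
  rewrite sumr_const mulr_natl; congr (_ *+ _).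
  by apply: eq_card => a; rewrite !inE.
have [b0 _|B0] := pickP (@predT B); last first.
  rewrite (@big_pred0 _ _ _ A); last by move=> a; have := B0 (phi a).
  by rewrite big_pred0 ?mulr0// => b; have := B0 b.
have Nc b : N b = N b0 by apply/eqP; rewrite eqn_leq !Nle.
have := sumE (fun=> 1); rewrite sumr_const => ->.
rewrite sumE; under [in LHS]eq_bigr do rewrite Nc.
under [in RHS]eq_bigr do rewrite Nc mulr1.
by rewrite -!mulr_sumr sumr_const; ring.
Qed.

End RealLemmas.

(** * Gallager-symmetric channels *)

Section SymmetricChannel.
Variables (R : realType) (X Y : finType) (W : X -> Y -> R).

Definition unif_out (y : Y) : R := #|X|%:R^-1 * \sum_x W x y.
(** Measured in nats, as is [unif_info], the mutual information at the uniform input; [capacityE]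
    converts to bits. *)
Definition info_density (x : X) (y : Y) : R := ln (W x y / unif_out y).
Definition unif_info : R :=
  #|X|%:R^-1 * \sum_x \sum_y W x y * info_density x y.

Hypotheses (x0 : X) (dmcW : is_dmc W) (symW : gallager_symmetric W).

Let W_ge0 x y : 0 <= W x y. Proof. exact: dmcW.1. Qed.

Let cardX_gt0 : 0 < #|X|%:R :> R.
Proof. by rewrite ltr0n; apply/card_gt0P; exists x0. Qed.

Lemma unif_out_ge0 y : 0 <= unif_out y.
Proof. by apply: mulr_ge0; [rewrite invr_ge0 ltW|apply: sumr_ge0]. Qed.

Lemma sum_unif_out : \sum_y unif_out y = 1.
Proof.
rewrite -mulr_sumr exchange_big/=.
rewrite (eq_bigr (fun=> 1)) => [|x _]; last exact: dmcW.2.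
by rewrite sumr_const mulVf// gt_eqF.
Qed.

Lemma unif_out_gt0 x y : 0 < W x y -> 0 < unif_out y.
Proof.
move=> h; rewrite mulr_gt0 ?invr_gt0//.
by rewrite (bigD1 x)//= ltr_pwDl// sumr_ge0.
Qed.

Lemma expR_info_density x y :
  0 < W x y -> expR (info_density x y) = W x y / unif_out y.
Proof.
by move=> h; rewrite lnK// posrE divr_gt0// (unif_out_gt0 h).
Qed.

(* On a block of Gallager's partition the columns are permutations of each
   other, so [unif_out] is constant there; the rows are permutations of each
   other, so the joint law of [(W x y, unif_out y)] does not depend on [x]. *)
Lemma symmetric_sum (g : R -> R -> R) x x' :
  \sum_y g (W x y) (unif_out y) = \sum_y g (W x' y) (unif_out y).
Proof.
have [P [Ppart hP]] := symW.
have sumP h : \sum_(y : Y) h y = \sum_(B in P) \sum_(y in B) h y :> R.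
  by rewrite -(set_partition_big _ Ppart)/=; apply: eq_bigl => y; rewrite inE.
rewrite !sumP; apply: eq_bigr => B BP.
have [hrow hcol] := hP B BP.
have oconst y y' : y \in B -> y' \in B -> unif_out y' = unif_out y.
  move=> yB y'B; have [s hs] := hcol y y' yB y'B.
  rewrite /unif_out; congr (_ * _).
  by rewrite [RHS](reindex_inj (@perm_inj _ s)); apply: eq_bigr.
have [s hs] := hrow x' x.
have sB : [set s y | y in B] = B.
  apply/eqP; rewrite eqEcard card_imset ?leqnn ?andbT; last exact: perm_inj.
  by apply/fintype.subsetP => _ /imsetP[y /hs[? _] ->].
rewrite -[in RHS]sB big_imset/=; last by move=> ? ? _ _; apply: perm_inj.
apply: eq_bigr => y yB; have [sy ->] := hs y yB.
by rewrite (oconst y (s y)).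
Qed.

(** The Kuhn-Tucker condition with equality at every input, which is why the uniform input is
    optimal. *)
Lemma mean_info_density x : \sum_y W x y * info_density x y = unif_info.
Proof.
rewrite /unif_info [X in _ * X](eq_bigr (fun=> \sum_y W x y * info_density x y)).
  by rewrite sumr_const -[X in _ * X]mulr_natl mulKf// gt_eqF.
by move=> x' _; apply: (symmetric_sum (fun a b => a * ln (a / b))).
Qed.

(** The gap is the divergence from [unif_out] of the output law [r] of [p]; it is nonnegative by
    [ln x <= x - 1]. *)
Lemma mutual_info_le_unif (p : X -> R) :
  is_distr p -> mutual_info p W * ln 2 <= unif_info.
Proof.
move=> [p0 p1]; rewrite /mutual_info mulr_suml.
set r := fun y => \sum_x' p x' * W x' y.
have r0 y : 0 <= r y by apply: sumr_ge0 => x _; apply: mulr_ge0.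
apply: (@le_trans _ _ (\sum_x \sum_y
    (p x * W x y * info_density x y + p x * W x y * (unif_out y / r y)
     - p x * W x y))).
  apply: ler_sum => x _; rewrite mulr_suml; apply: ler_sum => y _.
  have [->|pW] := eqVneq (p x * W x y) 0; first by rewrite !mul0r addr0 subr0.
  have pW0 : 0 < p x * W x y by rewrite lt_neqAle eq_sym pW mulr_ge0.
  have W0 : 0 < W x y.
    by rewrite lt_neqAle W_ge0 andbT eq_sym; apply: contraNneq pW => ->; rewrite mulr0.
  have ry : 0 < r y.
    apply: lt_le_trans pW0 _; rewrite /r (bigD1 x)//= lerDl.
    by apply: sumr_ge0 => x' _; apply: mulr_ge0.
  have oy := unif_out_gt0 W0.
  rewrite -/(r y) /log2 -mulrA mulfVK ?gt_eqF ?ln2_gt0//.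
  rewrite -mulrDr -[X in _ <= _ - X]mulr1 -mulrBr ler_pM2l//.
  have -> : W x y / r y = (W x y / unif_out y) * (unif_out y / r y).
    by field; rewrite !gt_eqF.
  rewrite lnM ?posrE ?divr_gt0// -addrA lerD2l.
  by apply: ln_le_subr1; rewrite divr_gt0.
under eq_bigr do rewrite sumrB big_split/=.
rewrite sumrB big_split/=.
have -> : \sum_x \sum_y p x * W x y = 1.
  rewrite -[RHS]p1; apply: eq_bigr => x _.
  by rewrite -mulr_sumr dmcW.2 mulr1.
have -> : \sum_x \sum_y p x * W x y * info_density x y = unif_info.
  under eq_bigr do under eq_bigr do rewrite -mulrA.
  under eq_bigr do rewrite -mulr_sumr mean_info_density.
  by rewrite -mulr_suml p1 mul1r.
(* Only an inequality: an output with [r y = 0] contributes 0 on the left and [unif_out y] on the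
   right. *)
have : \sum_x \sum_y p x * W x y * (unif_out y / r y) <= 1.
  rewrite exchange_big/= -sum_unif_out; apply: ler_sum => y _.
  rewrite -mulr_suml -/(r y); have [->|ry] := eqVneq (r y) 0.
    by rewrite mul0r unif_out_ge0.
  by rewrite mulrCA mulfV// mulr1.
lra.
Qed.

Lemma mutual_info_unif :
  mutual_info (fun=> #|X|%:R^-1) W * ln 2 = unif_info.
Proof.
rewrite /mutual_info /unif_info mulr_suml mulr_sumr; apply: eq_bigr => x _.
rewrite mulr_suml mulr_sumr; apply: eq_bigr => y _.
rewrite -mulr_sumr -/(unif_out y) /log2 /info_density.
case: eqVneq => [h|_]; first by rewrite mul0r mulrA h mul0r.
by rewrite -[in LHS]mulrA mulfVK ?gt_eqF ?ln2_gt0// mulrA.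
Qed.

Lemma capacityE : capacity W * ln 2 = unif_info.
Proof.
have ud : is_distr (fun _ : X => #|X|%:R^-1 : R).
  split=> [x|]; first by rewrite invr_ge0 ltW.
  by rewrite sumr_const -(mulr_natl #|X|%:R^-1) mulfV// gt_eqF.
have ub : ubound [set z | exists p : X -> R, is_distr p /\ z = mutual_info p W]
    (unif_info / ln 2).
  by move=> _ [p [/mutual_info_le_unif h ->]]; rewrite ler_pdivlMr ?ln2_gt0.
apply: le_anti; apply/andP; split.
  rewrite -ler_pdivlMr ?ln2_gt0//; apply: ge_sup => //.
  by exists (mutual_info (fun=> #|X|%:R^-1) W), (fun=> #|X|%:R^-1).
rewrite -mutual_info_unif ler_pM2r ?ln2_gt0//.
apply: ub_le_sup; first by exists (unif_info / ln 2).
by exists (fun=> #|X|%:R^-1).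
Qed.

Lemma unif_info_ge0 : 0 <= unif_info.
Proof.
rewrite -(mean_info_density x0) -oppr_le0 -sumrN.
apply: (@le_trans _ _ (\sum_y (unif_out y - W x0 y))); last first.
  by rewrite sumrB sum_unif_out dmcW.2 subrr.
apply: ler_sum => y _; have [->|W0] := eqVneq (W x0 y) 0.
  by rewrite mul0r oppr0 addr0 unif_out_ge0.
have {}W0 : 0 < W x0 y by rewrite lt_neqAle eq_sym W0 W_ge0.
have oy := unif_out_gt0 W0.
have := ln_le_subr1 (divr_gt0 oy W0).
rewrite -[X in ln X]invf_div lnV ?posrE ?divr_gt0// -/(info_density x0 y).
move=> h; rewrite -mulrN; apply: le_trans (ler_wpM2l (ltW W0) h) _.
by rewrite mulrBr mulr1 mulrCA mulfV ?mulr1// gt_eqF.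
Qed.

(** To first order in [s] the exponential moments depend only on the mean [unif_info], common to all
    inputs; [delta] absorbs the second order. The first bound serves the converse, the second the
    affine codes. *)
Lemma mgf_info_density (delta : R) : 0 < delta ->
  exists2 s1, 0 < s1 & forall s, 0 < s <= s1 -> forall x,
    \sum_y W x y * expR (s * info_density x y) <=
      expR (s * (unif_info + delta)) /\
    \sum_y W x y * expR (- s * info_density x y) <=
      expR (- s * (unif_info - delta)).
Proof.
move=> d0; pose K := 1 + \sum_x \sum_y `|info_density x y|.
have K1 : 1 <= K by rewrite lerDl !sumr_ge0// => x _; apply: sumr_ge0.
have lK x y : `|info_density x y| <= K.
  rewrite /K (bigD1 x)//= (bigD1 y)//=.
  have A0 : 0 <= \sum_(y' | y' != y) `|info_density x y'| by exact: sumr_ge0.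
  have B0 : 0 <= \sum_(x' | x' != x) \sum_y' `|info_density x' y'|.
    by apply: sumr_ge0 => x' _; apply: sumr_ge0.
  lra.
have bound u x : `|u| * K <= 1 / 2 ->
    \sum_y W x y * expR (u * info_density x y) <=
    expR (u * unif_info + 2 * u ^+ 2 * K ^+ 2).
  move=> uK; apply: le_trans (expR_ge1Dx _).
  have -> : 1 + (u * unif_info + 2 * u ^+ 2 * K ^+ 2) =
      \sum_y (W x y * 1 + u * (W x y * info_density x y)
              + W x y * (2 * u ^+ 2 * K ^+ 2)).
    rewrite !big_split/= -!mulr_suml -mulr_sumr mean_info_density dmcW.2.
    by rewrite !mul1r addrA.
  apply: ler_sum => y _; rewrite mulrCA -!mulrDr ler_wpM2l//.
  have h : `|u * info_density x y| <= `|u| * K by rewrite normrM ler_wpM2l.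
  apply: le_trans (expR_le_quadratic _) _.
    by apply: le_trans (ler_norm _) _; apply: le_trans h uK.
  rewrite lerD2l exprMn -[leRHS]mulrA ler_wpM2l// ler_wpM2l ?sqr_ge0//.
  by rewrite -[leLHS]real_normK ?num_real// lerXn2r ?nnegrE// (le_trans ler01).
(* The first entry keeps the exponents below 1/2, where the quadratic estimate applies; the second
   makes [2 s^2 K^2] at most [s delta]. *)
exists (Num.min (1 / (2 * K)) (delta / (2 * K ^+ 2))).
  have K0 : 0 < K by lra.
  by rewrite lt_min !divr_gt0 ?mulr_gt0 ?exprn_gt0.
move=> s /andP[s0]; rewrite le_min => /andP[sK sd] x.
have K0 : 0 < K by lra.
rewrite ler_pdivlMr ?mulr_gt0// in sK.
rewrite ler_pdivlMr ?mulr_gt0 ?exprn_gt0// in sd.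
have sabs : `|s| * K <= 1 / 2 by rewrite gtr0_norm//; lra.
have e : 2 * s ^+ 2 * K ^+ 2 <= s * delta.
  have := ler_wpM2l (ltW s0) sd; nra.
split; (apply: le_trans (bound _ _ _) _; [by rewrite ?normrN|]);
  rewrite ler_expR ?sqrrN; lra.
Qed.

End SymmetricChannel.

(** * Sums over output trajectories *)

Section TrajectorySums.
Variable R : realType.

(** The alphabets [T i] differ; passing through [fprod] gives a sum over functions into a tagged
    union, where ordinary distributivity applies. *)
Lemma sum_dffun_prod (I : finType) (T : I -> finType)
    (g : forall i, T i -> R) :
  \sum_(f : {dffun forall i, T i}) \prod_i g i (f i) = \prod_i \sum_x g i x.
Proof.
rewrite (reindex (@dffun_of_fprod I T)); last first.
  exact/onW_bij/dffun_of_fprod_bij.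
transitivity (\sum_(f : fprod T) \prod_(i in I) [ffun x => g i x] (f i)).
  by apply: eq_bigr => f _; apply: eq_bigr => i _; rewrite !ffunE.
rewrite big_fprod; under [RHS]eq_bigr do rewrite big_tag.
rewrite [RHS]bigA_distr_big_dep; apply: eq_bigr => f _; apply: eq_bigr => i _.
by rewrite /untag; case: eqP => // e; rewrite ffunE.
Qed.

Variables (n N : nat) (Y : 'I_n -> finType).
Implicit Types (y : traj Y N) (v : 'I_n) (t : 'I_N) (S : {set 'I_n}).

Lemma sum_traj_prod (w : forall v, 'I_N -> Y v -> R) :
  \sum_(y : traj Y N) \prod_v \prod_t w v t (y v t) =
  \prod_v \prod_t \sum_b w v t b.
Proof.
rewrite (@sum_dffun_prod _ (fun v => {ffun 'I_N -> Y v})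
  (fun v f => \prod_t w v t (f t))).
by apply: eq_bigr => v _; rewrite bigA_distr_bigA.
Qed.

Definition traj_upd y v t (b : Y v) : traj Y N :=
  finfun (dfwith y [ffun i => if i == t then b else y v i]).

Lemma traj_updE y v t (b : Y v) : traj_upd y t b v t = b.
Proof. by rewrite ffunE dfwith_in ffunE eqxx. Qed.

Lemma traj_updNE y v t (b : Y v) w i :
  (v, t) != (w, i) -> traj_upd y t b w i = y w i.
Proof.
rewrite ffunE; have [<-{w}|vw] := eqVneq v w; last by rewrite dfwith_out.
rewrite dfwith_in ffunE xpair_eqE eqxx eq_sym/=.
by case: eqVneq.
Qed.

Lemma traj_ext y y' : (forall v t, y v t = y' v t) -> y = y'.
Proof. by move=> h; apply/ffunP => v; apply/ffunP => t. Qed.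

(** Exchanging the old symbol at [(v, t)] with the new one is an involution on pairs of a trajectory
    and a symbol. *)
Lemma sum_traj_resample v t (H : traj Y N -> R) :
  \sum_y \sum_(b : Y v) H (traj_upd y t b) = #|Y v|%:R * \sum_y H y.
Proof.
pose sw (p : traj Y N * Y v) := (traj_upd p.1 t p.2, p.1 v t).
have swK : involutive sw.
  case=> y b; rewrite /sw/= traj_updE; congr (_, _); apply: traj_ext => w i.
  have [[<- <-]|vw] := eqVneq (v, t) (w, i); first by rewrite traj_updE.
  by rewrite !traj_updNE.
rewrite pair_big/= (reindex_inj (inv_inj swK))/=.
rewrite (eq_bigr (fun p => H p.1)) => [|[y b] _]; last first.
  by have /(congr1 fst) := swK (y, b); rewrite /sw/= => ->.
rewrite -(pair_big predT predT (fun y _ => H y))/= mulr_sumr.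
by apply: eq_bigr => y _; rewrite sumr_const mulr_natl.
Qed.

(* Peel off the coordinates in [S] one at a time, latest time first: by
   causality no remaining kernel depends on the coordinate being summed. *)
Lemma causal_sum S (G : traj Y N -> R)
    (K : forall v, 'I_N -> traj Y N -> Y v -> R) (k : 'I_n -> 'I_N -> R) :
  (forall y y', (forall v, v \notin S -> y v = y' v) -> G y = G y') ->
  (forall v t y y' b, (forall w (i : 'I_N), (i < t)%N -> y w i = y' w i) ->
     K v t y b = K v t y' b) ->
  (forall v t y, v \in S -> \sum_b K v t y b = k v t) ->
  \sum_y G y * \prod_(v in S) \prod_t K v t y (y v t) =
  \sum_y G y * \prod_(v in S) \prod_t (k v t / #|Y v|%:R).
Proof.
move=> hG hK hk.
(* Coordinates already summed out stay in the range of [y]; division by [#|Y v|] compensates for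
   this, and [c] collects their factors. *)
suff claim (A : {set 'I_n * 'I_N}) (c : R) :
    (forall p, p \in A -> p.1 \in S) ->
    \sum_y c * G y * \prod_(p in A) K p.1 p.2 y (y p.1 p.2) =
    \sum_y c * G y * \prod_(p in A) (k p.1 p.2 / #|Y p.1|%:R).
  have inS p : p \in [set p : 'I_n * 'I_N | p.1 \in S] -> p.1 \in S.
    by rewrite inE.
  have pE (f : 'I_n -> 'I_N -> R) : \prod_(v in S) \prod_t f v t =
      \prod_(p in [set p : 'I_n * 'I_N | p.1 \in S]) f p.1 p.2.
    by rewrite pair_big/=; apply: eq_bigl => -[v t]; rewrite inE andbT.
  transitivity (\sum_y 1 * G y *
      \prod_(p in [set p | p.1 \in S]) K p.1 p.2 y (y p.1 p.2)).
    apply: eq_bigr => y _; rewrite mul1r.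
    by rewrite (pE (fun v t => K v t y (y v t))).
  rewrite (claim _ 1 inS).
  by apply: eq_bigr => y _; rewrite mul1r pE.
have [m Am] := ubnP #|A|; elim: m A c Am => // m IH A c Am AS.
have [->|[p0 p0A]] := set_0Vmem A; first by apply: eq_bigr => y _; rewrite !big_set0.
case: (arg_maxnP (fun p : 'I_n * 'I_N => val p.2) p0A) => -[v t] /= pA pmax.
have {}pA : (v, t) \in A by [].
have vS : v \in S by exact: (AS _ pA).
have [Yv0|Yv0] := posnP #|Y v|.
  have noy (y : traj Y N) : False.
    by have := fintype0 (y v t).
  by apply: eq_bigr => y; case: (noy y).
have Yv : #|Y v|%:R != 0 :> R by rewrite pnatr_eq0 -lt0n.
transitivity (\sum_y c * (k v t / #|Y v|%:R) * G y *
    \prod_(p in A :\ (v, t)) (k p.1 p.2 / #|Y p.1|%:R)); last first.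
  by apply: eq_bigr => y _; rewrite (big_setD1 _ pA)/= !mulrA; congr (_ * _); ring.
rewrite -IH; first last.
- by move=> p; rewrite inE => /andP[_ /AS].
- by move: Am; rewrite (cardsD1 (v, t)) pA.
apply: (mulfI Yv); rewrite -(sum_traj_resample v t).
rewrite mulr_sumr; apply: eq_bigr => y _.
rewrite (eq_bigr (fun b => c * G y *
     \prod_(p in A :\ (v, t)) K p.1 p.2 y (y p.1 p.2) * K v t y b)); last first.
    move=> b _; rewrite (big_setD1 _ pA)/= traj_updE mulrCA mulrC.
    congr (_ * _ * _ * _).
    - apply: hG => w wS; apply/ffunP => i; apply: traj_updNE.
      by apply: contraNneq wS => -[<- _].
    - apply: eq_bigr => -[w i]; rewrite !inE => /andP[ne wA]/=.
      rewrite traj_updNE 1?eq_sym//; apply: hK => w' i' ii'.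
      apply: traj_updNE; apply: contraTneq ii' => -[_ <-].
      by rewrite -leqNgt; exact: (pmax _ wA).
    - apply: hK => w i it; apply: traj_updNE.
      by apply: contraTneq it => -[_ <-]; rewrite ltnn.
rewrite -mulr_sumr hk//; by field.
Qed.

(** All nodes are peeled off. This yields total masses although channel inputs depend on past
    outputs. *)
Lemma causal_total (K : forall v, 'I_N -> traj Y N -> Y v -> R)
    (k : 'I_n -> 'I_N -> R) :
  (forall v, (0 < #|Y v|)%N) ->
  (forall v t y y' b, (forall w (i : 'I_N), (i < t)%N -> y w i = y' w i) ->
     K v t y b = K v t y' b) ->
  (forall v t y, \sum_b K v t y b = k v t) ->
  \sum_y \prod_v \prod_t K v t y (y v t) = \prod_v \prod_t k v t.
Proof.
move=> Y0 hK hk.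
have := @causal_sum finset.setT (fun=> 1) K k (fun _ _ _ => erefl) hK
  (fun v t y _ => hk v t y).
move=> h; transitivity (\sum_y 1 * \prod_(v in finset.setT) \prod_t K v t y (y v t)).
  apply: eq_bigr => y _; rewrite mul1r.
  by apply: eq_bigl => v; rewrite finset.in_setT.
rewrite h; transitivity (\sum_(y : traj Y N) \prod_v \prod_t (k v t / #|Y v|%:R)).
  apply: eq_bigr => y _; rewrite mul1r.
  by apply: eq_bigl => v; rewrite finset.in_setT.
rewrite (sum_traj_prod (fun v t _ => k v t / #|Y v|%:R)).
apply: eq_bigr => v _; apply: eq_bigr => t _.
by rewrite sumr_const -(mulr_natr (k v t / _)) mulfVK// pnatr_eq0 -lt0n.
Qed.

End TrajectorySums.

(** * Converse *)

Lemma powR2E (R : realType) (x : R) : 2 `^ x = expR (x * ln 2).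
Proof. by rewrite /powR pnatr_eq0. Qed.

Section Network.
Variables (R : realType) (n : nat) (F : 'I_n -> finFieldType).
Variables (Y : 'I_n -> finType) (W : forall v : 'I_n, F v -> Y v -> R).
Variables (e : rel (node n)) (beta : forall (u : node n) (v : 'I_n), F v).
Variable D : {set 'I_n}.
Arguments W : clear implicits.
Hypotheses (hdmc : forall v, is_dmc (W v)).
Hypotheses (hsym : forall v, gallager_symmetric (W v)).

Let W_ge0 v x y : 0 <= W v x y. Proof. exact: (hdmc v).1. Qed.

Lemma output_nonempty v : (0 < #|Y v|)%N.
Proof.
rewrite lt0n; apply/eqP => Y0; have := (hdmc v).2 0.
rewrite big_pred0 => [/eqP|y]; first by rewrite eq_sym oner_eq0.
by have := fintype0 y.
Qed.

Lemma chan_in_causal N M (c : code F Y N M) v (t : 'I_N) (m : 'I_M)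
    (y y' : traj Y N) :
  (forall w (i : 'I_N), (i < t)%N -> y w i = y' w i) ->
  chan_in e beta c v t m y = chan_in e beta c v t m y'.
Proof.
move=> h; apply: eq_bigr => -[u|] _ //; congr (_ * _).
by apply: rly_causal => i it; apply: h.
Qed.

Lemma sum_traj_prob N M (c : code F Y N M) m :
  \sum_y traj_prob W e beta c m y = 1.
Proof.
rewrite /traj_prob (causal_total (K := fun v t y b => W v (chan_in e beta c v t m y) b)
  (k := fun _ _ => 1)).
- by rewrite big1// => v _; rewrite big1.
- exact: output_nonempty.
- by move=> v t y y' b /chan_in_causal ->.
- by move=> v t y; exact: (hdmc v).2.
Qed.

(** * The change of measure across a cut *)

Section CutBound.
Variables (N M : nat) (c : code F Y N M) (S : {set node n}).
Local Notation B := (cut_boundary e S).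

Let dens (m : 'I_M) v (t : 'I_N) (y : traj Y N) :=
  info_density (W v) (chan_in e beta c v t m y) (y v t).

Definition cut_kernel (m : 'I_M) v (t : 'I_N) (y : traj Y N) (b : Y v) : R :=
  if v \in B then unif_out (W v) b else W v (chan_in e beta c v t m y) b.

Definition cut_prob m (y : traj Y N) : R :=
  \prod_v \prod_t cut_kernel m t y (y v t).

(** The true law weighted by the exponential of [s] times the information density across the cut.
    The weight is spread over the coordinates to keep the causal product form. *)
Definition tilted_prob (s : R) m (y : traj Y N) : R :=
  \prod_v \prod_t (W v (chan_in e beta c v t m y) (y v t) *
    (if v \in B then expR (s * dens m v t y) else 1)).

Lemma cut_kernel_ge0 m v t y b : 0 <= cut_kernel m t y (b : Y v).
Proof.
rewrite /cut_kernel; case: ifP => // _.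
exact: (unif_out_ge0 (0 : F v) (hdmc v)).
Qed.

Lemma cut_prob_ge0 m y : 0 <= cut_prob m y.
Proof.
by apply: prodr_ge0 => v _; apply: prodr_ge0 => t _; apply: cut_kernel_ge0.
Qed.

Lemma tilted_prob_ge0 s m y : 0 <= tilted_prob s m y.
Proof.
apply: prodr_ge0 => v _; apply: prodr_ge0 => t _; apply: mulr_ge0 => //.
by case: ifP => // _; apply: expR_ge0.
Qed.

(** Let [L] be the logarithm of the ratio of the true law to [cut_prob]. If [L <= l] the second term
    dominates; otherwise [exp (s (L - l)) >= 1] and the first does. *)
Lemma traj_prob_le_tilted (s l : R) m y : 0 <= s ->
  traj_prob W e beta c m y <=
  expR (- (s * l)) * tilted_prob s m y + expR l * cut_prob m y.
Proof.
move=> s0.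
have T0 := tilted_prob_ge0 s m y.
have C0 := cut_prob_ge0 m y.
(* Zero probabilities are set aside so that the likelihood ratio is a genuine quotient. *)
have [->|P0] := eqVneq (traj_prob W e beta c m y) 0.
  by rewrite addr_ge0// mulr_ge0// expR_ge0.
have Wpos v t : 0 < W v (chan_in e beta c v t m y) (y v t).
  rewrite lt_neqAle W_ge0 eq_sym andbT.
  by move/prodf_neq0: P0 => /(_ v isT)/prodf_neq0/(_ t isT).
have Ppos : 0 < traj_prob W e beta c m y.
  by apply: prodr_gt0 => v _; apply: prodr_gt0.
pose L := \sum_v \sum_t (if v \in B then dens m v t y else 0).
have TE : tilted_prob s m y = traj_prob W e beta c m y * expR (s * L).
  rewrite /L mulr_sumr expR_sum -big_split/=; apply: eq_bigr => v _.
  rewrite mulr_sumr expR_sum -big_split/=; apply: eq_bigr => t _.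
  by case: ifP => // _; rewrite mulr0 expR0.
have CE : cut_prob m y * expR L = traj_prob W e beta c m y.
  rewrite /L expR_sum -big_split/=; apply: eq_bigr => v _.
  rewrite expR_sum -big_split/=; apply: eq_bigr => t _.
  rewrite /cut_kernel; case: ifP => _; last by rewrite expR0 mulr1.
  rewrite (expR_info_density (0 : F v) (hdmc v) (Wpos v t)) mulrCA mulfV ?mulr1// gt_eqF//.
  exact: (unif_out_gt0 (0 : F v) (hdmc v) (Wpos v t)).
have [Ll|lL] := leP L l.
  apply: ler_wpDl; first by rewrite mulr_ge0 ?expR_ge0.
  by rewrite -CE mulrC ler_wpM2r// ler_expR.
apply: ler_wpDr; first by rewrite mulr_ge0 ?expR_ge0.
rewrite TE mulrCA; apply: ler_peMr; first exact: ltW.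
rewrite -expRD -[leLHS]expR0 ler_expR.
by rewrite addrC -mulrBr mulr_ge0// subr_ge0 ltW.
Qed.

(** By symmetry the tilted moment at a boundary node is the same for every input, so the input may
    be replaced by 0 whatever the relays do. *)
Lemma sum_tilted_prob (s : R) m :
  \sum_y tilted_prob s m y =
  \prod_(v in B) (\sum_b W v (0 : F v) b * expR (s * info_density (W v) 0 b)) ^+ N.
Proof.
rewrite /tilted_prob (causal_total
  (K := fun v t y b => W v (chan_in e beta c v t m y) b * (if v \in B then
     expR (s * info_density (W v) (chan_in e beta c v t m y) b) else 1))
  (k := fun v _ => if v \in B then
     \sum_b W v (0 : F v) b * expR (s * info_density (W v) 0 b) else 1)).
- rewrite [RHS]big_mkcond/=; apply: eq_bigr => v _.
  by case: ifP => _; [rewrite prodr_const card_ord|rewrite big1].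
- exact: output_nonempty.
- by move=> v t y y' b /chan_in_causal ->.
- move=> v t y; case: ifP => _.
    exact: (symmetric_sum (hsym v) (fun a b => a * expR (s * ln (a / b)))).
  by under eq_bigr do rewrite mulr1; exact: (hdmc v).2.
Qed.

(** A far-side node off the boundary hears only far-side nodes, and the source is not among them. On
    the boundary the kernel ignores its input. *)
Lemma cut_kernel_indep m m' v t (y y' : traj Y N) b :
  None \in S -> Some v \notin S ->
  (forall w, Some w \notin S -> y w = y' w) ->
  cut_kernel m t y (b : Y v) = cut_kernel m' t y' b.
Proof.
move=> NS vS h; rewrite /cut_kernel inE vS/=.
case: ifPn => //; rewrite negb_exists => /forallP nb.
congr (W _ _ b); apply: eq_bigr => u eu.
have := nb u; rewrite eu andbT; case: u eu => [u|] eu uS; last by rewrite NS in uS.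
by rewrite h.
Qed.

(** Under [cut_prob] the far-side outputs have one law for all messages, and each output sequence is
    decoded to exactly one message. *)
Lemma sum_cut_prob_dec d : None \in S -> Some d \notin S ->
  \sum_m \sum_(y : traj Y N) (dec c (y d) == m)%:R * cut_prob m y <= 1.
Proof.
move=> NS dS; pose So := [set v | Some v \in S].
have [M0|M0] := posnP M.
  by rewrite big1// => m; exfalso; move: m => [m]; rewrite M0.
pose m0 : 'I_M := Ordinal M0.
(* The near-side outputs are replaced by uniform ones through [causal_sum]; the far-side kernels may
   then be those of [m0]. *)
have fixm (m : 'I_M) : \sum_(y : traj Y N) (dec c (y d) == m)%:R * cut_prob m y =
    \sum_(y : traj Y N) (dec c (y d) == m)%:R *
      (\prod_(v in ~: So) \prod_t cut_kernel m0 t y (y v t)) *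
      \prod_(v in So) \prod_(t < N) (1 / #|Y v|%:R).
  have hG (y y' : traj Y N) : (forall v, v \notin So -> y v = y' v) ->
      (dec c (y d) == m)%:R *
        \prod_(v in ~: So) \prod_t cut_kernel m0 t y (y v t) =
      (dec c (y' d) == m)%:R *
        \prod_(v in ~: So) \prod_t cut_kernel m0 t y' (y' v t).
    move=> h; have h' w : Some w \notin S -> y w = y' w.
      by move=> wS; apply: h; rewrite inE.
    rewrite h'//; congr (_ * _); apply: eq_bigr => v; rewrite !inE => vS.
    by apply: eq_bigr => t _; rewrite h'//; apply: cut_kernel_indep.
  have hK v (t : 'I_N) (y y' : traj Y N) (b : Y v) :
      (forall w (i : 'I_N), (i < t)%N -> y w i = y' w i) ->
      W v (chan_in e beta c v t m y) b = W v (chan_in e beta c v t m y') b.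
    by move=> /chan_in_causal ->.
  refine (etrans _ (causal_sum (k := fun _ _ => 1) hG hK _)); last first.
    by move=> v t y vS; exact: (hdmc v).2.
  apply: eq_bigr => y _; rewrite -mulrA; congr (_ * _).
  rewrite /cut_prob (bigID (fun v => v \in So))/= mulrC; congr (_ * _).
    apply: eq_big => [v|v]; rewrite ?inE// => vS; apply: eq_bigr => t _.
    exact: cut_kernel_indep.
  apply: eq_bigr => v; rewrite inE => vS; apply: eq_bigr => t _.
  by rewrite /cut_kernel inE vS.
under eq_bigr do rewrite fixm.
rewrite exchange_big/=.
rewrite (eq_bigr (fun y => \prod_v \prod_t
   (if v \in So then 1 / #|Y v|%:R else cut_kernel m0 t y (y v t)))); last first.
  move=> y _; rewrite -!mulr_suml (bigD1 (dec c (y d)))//= eqxx big1 => [|m].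
    rewrite addr0 mul1r [RHS](bigID (fun v => v \in So))/= mulrC; congr (_ * _).
      by apply: eq_bigr => v vS; rewrite vS.
    by apply: eq_big => [v|v]; rewrite inE// => /negbTE ->.
  by rewrite eq_sym => /negbTE ->.
rewrite (causal_total (K := fun v t y b =>
    if v \in So then 1 / #|Y v|%:R else cut_kernel m0 t y b) (k := fun _ _ => 1)).
- by rewrite big1// => v _; rewrite big1.
- exact: output_nonempty.
- by move=> v t y y' b h; rewrite /cut_kernel (chan_in_causal _ _ _ h).
- move=> v t y; case: (v \in So).
    rewrite sumr_const -(mulr_natr (1 / _)) mulfVK//.
    by rewrite pnatr_eq0 -lt0n output_nonempty.
  rewrite /cut_kernel; case: (v \in B); last exact: (hdmc v).2.
  exact: (sum_unif_out (0 : F v) (hdmc v)).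
Qed.

(** The change of measure is summed over messages and trajectories. It is enough to follow one
    destination beyond the cut, since success requires it to decode. *)
Lemma cut_bound (s l : R) : is_cut D S -> 0 <= s ->
  M%:R * (1 - err_prob W e beta D c) <= M%:R * (expR (- (s * l)) *
    \prod_(v in B) (\sum_b W v (0 : F v) b * expR (s * info_density (W v) 0 b)) ^+ N)
  + expR l.
Proof.
move=> /andP[NS /existsP[d /andP[dD dS]]] s0.
have [->|M0] := eqVneq (M%:R : R) 0; first by rewrite !mul0r add0r expR_ge0.
have -> : M%:R * (1 - err_prob W e beta D c) = \sum_m \sum_(y : traj Y N)
    (if [exists d in D, dec c (y d) != m] then 0 else traj_prob W e beta c m y).
  rewrite mulrBr mulr1 /err_prob mulrA mulfV// mul1r.
  rewrite (_ : M%:R = \sum_(m < M) 1 :> R); last first.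
    by rewrite sumr_const card_ord.
  rewrite -sumrB; apply: eq_bigr => m _; rewrite -(sum_traj_prob c m) -sumrB.
  by apply: eq_bigr => y _; case: ifP => _; rewrite ?subrr ?subr0.
apply: (@le_trans _ _ (\sum_m \sum_(y : traj Y N) (expR (- (s * l)) * tilted_prob s m y +
    expR l * ((dec c (y d) == m)%:R * cut_prob m y)))).
  apply: ler_sum => m _; apply: ler_sum => y _.
  have T0 := tilted_prob_ge0 s m y.
  have C0 := cut_prob_ge0 m y.
  case: ifPn => [_|]; first by rewrite addr_ge0 ?mulr_ge0 ?expR_ge0.
  rewrite negb_exists => /forallP/(_ d); rewrite dD/= negbK => ->.
  by rewrite mul1r; apply: traj_prob_le_tilted.
rewrite (eq_bigr (fun m => expR (- (s * l)) * \prod_(v in B) (\sum_b W v (0 : F v) b *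
    expR (s * info_density (W v) 0 b)) ^+ N +
  expR l * \sum_(y : traj Y N) (dec c (y d) == m)%:R * cut_prob m y)); last first.
  by move=> m _; rewrite big_split/= -!mulr_sumr sum_tilted_prob.
rewrite big_split/= sumr_const card_ord -(mulr_natl (_ * _)) lerD2l -mulr_sumr.
by rewrite ler_piMr ?expR_ge0// sum_cut_prob_dec.
Qed.

End CutBound.

(** Above the cut value both terms of [cut_bound] are eventually at most [M / 4], so the success
    probability is at most 1/2, against 3/4 for a code with error at most 1/4. *)
Lemma achievable_le_cut (r : R) (S : {set node n}) :
  achievable W e beta D r -> is_cut D S ->
  r * ln 2 <= \sum_(v in cut_boundary e S) unif_info (W v).
Proof.
move=> ach Scut; set C := \sum_(v in _) _; set B := cut_boundary e S.
rewrite leNgt; apply/negP => Cr.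
pose delta := (r * ln 2 - C) / 2.
have d0 : 0 < delta by rewrite divr_gt0// subr_gt0.
(* At most [n] boundary nodes lose [d1] each, together at most [delta / 2]. *)
pose d1 := delta / (2 * n.+1%:R).
have d10 : 0 < d1 by rewrite divr_gt0// mulr_gt0// ltr0n.
have [s s0 hs] : exists2 s : R, 0 < s & forall v,
    \sum_b W v (0 : F v) b * expR (s * info_density (W v) 0 b) <=
    expR (s * (unif_info (W v) + d1)).
  apply: common_pos => v.
  have [s1 s10 h] := mgf_info_density (0 : F v) (hdmc v) (hsym v) d10.
  by exists s1 => // s /h/(_ 0)[].
have [N1 hN1] := expR_decay 0 (mulr_gt0 s0 (divr_gt0 d0 (ltr0Sn R 1)))
  (divr_gt0 ltr01 (ltr0Sn R 3)).
have [N2 hN2] := expR_decay 0 d0 (divr_gt0 ltr01 (ltr0Sn R 3)).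
have [N0 hN0] := ach (1 / 4) ltac:(lra).
pose N := maxn N0 (maxn N1 N2).
have [M [c [hM herr]]] := hN0 N (leq_maxl _ _).
have {}hN1 := hN1 N (leq_trans (leq_maxl _ _) (leq_maxr _ _)).
have {}hN2 := hN2 N (leq_trans (leq_maxr _ _) (leq_maxr _ _)).
rewrite powR2E in hM.
have M0 : 0 < M%:R :> R by apply: lt_le_trans hM; exact: expR_gt0.
(* The threshold is [N delta] above the typical density [N C] and at least [N delta] below
   [ln M]. *)
pose l := N%:R * (C + delta).
have /(_ s l Scut (ltW s0)) := cut_bound c (S := S).
have prodle : \prod_(v in B) (\sum_b W v (0 : F v) b *
    expR (s * info_density (W v) 0 b)) ^+ N <= expR (N%:R * (s * (C + delta / 2))).
  apply: (@le_trans _ _ (\prod_(v in B) expR (N%:R * (s * (unif_info (W v) + d1))))).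
    apply: ler_prod => v _; apply/andP; split.
      apply: exprn_ge0; apply: sumr_ge0 => b _; apply: mulr_ge0 => //.
      exact: expR_ge0.
    rewrite expRM_natl lerXn2r ?nnegrE ?expR_ge0//.
    apply: sumr_ge0 => b _; apply: mulr_ge0 => //; exact: expR_ge0.
  rewrite -expR_sum ler_expR -mulr_sumr; apply: ler_wpM2l => //.
  rewrite -mulr_sumr; apply: ler_wpM2l; first exact: ltW.
  rewrite big_split/= -/C lerD2l sumr_const -(mulr_natl d1).
  have cB : #|B|%:R <= n.+1%:R :> R.
    by rewrite ler_nat ltnW// ltnS -[leqRHS]card_ord max_card.
  apply: le_trans (ler_wpM2r (ltW d10) cB) _.
  have : n.+1%:R != 0 :> R by rewrite pnatr_eq0.
  rewrite /d1 => n0; rewrite le_eqVlt; apply/orP; left; apply/eqP.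
  by move: (_%:R) n0 => k k0; field.
set Pr := \prod_(v in _) _ in prodle *.
have t1 : expR (- (s * l)) * Pr <= 1 / 4.
  apply: le_trans (ler_wpM2l (expR_ge0 _) prodle) _.
  rewrite -expRD; apply: le_trans hN1; rewrite ler_expR /l; nra.
have t2 : expR l <= 1 / 4 * M%:R.
  apply: le_trans (ler_wpM2l _ hM); last by lra.
  have -> : l = (0 - N%:R * delta) + N%:R * r * ln 2.
    by rewrite /l /delta; field.
  by rewrite expRD ler_wpM2r ?expR_ge0.
rewrite leNgt => /negP; apply.
have e1 : M%:R * (expR (- (s * l)) * Pr) <= M%:R * (1 / 4) by rewrite ler_wpM2l// ltW.
have e2 : M%:R * (3 / 4) <= M%:R * (1 - err_prob W e beta D c).
  by apply: ler_wpM2l; [exact: ltW|move: herr; lra].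
by nra.
Qed.

End Network.

(** * Affine codes for a symmetric channel *)

Section AffineCode.
Variables (R : realType) (F : finFieldType) (Y : finType) (W : F -> Y -> R).
Hypotheses (dmcW : is_dmc W) (symW : gallager_symmetric W).

Let W_ge0 x y : 0 <= W x y. Proof. exact: dmcW.1. Qed.
Let Q_ge0 y : 0 <= unif_out W y. Proof. exact: (unif_out_ge0 0 dmcW). Qed.

Section FixedLength.
Variables (L : nat) (l : R).
Implicit Types (u : 'rV[F]_L) (y : {ffun 'I_L -> Y}).

Definition block_chan u y : R := \prod_i W (u 0 i) (y i).
Definition block_out y : R := \prod_i unif_out W (y i).
(** The block information density exceeds [l], written as a product so that zero probabilities need
    no convention. *)
Definition likely u y : bool := expR l * block_out y < block_chan u y.

Lemma block_chan_ge0 u y : 0 <= block_chan u y.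
Proof. exact: prodr_ge0. Qed.

Lemma sum_block_chan u : \sum_y block_chan u y = 1.
Proof.
rewrite -(bigA_distr_bigA (fun i b => W (u 0 i) b)) big1// => i _.
exact: dmcW.2.
Qed.

Lemma sum_row_prod (g : 'I_L -> F -> R) :
  \sum_(u : 'rV[F]_L) \prod_i g i (u 0 i) = \prod_i \sum_x g i x.
Proof.
rewrite bigA_distr_bigA.
rewrite (reindex (fun f : {ffun 'I_L -> F} => \row_i f i)) /=.
  by apply: eq_bigr => f _; apply: eq_bigr => i _; rewrite mxE.
exists (fun u : 'rV[F]_L => [ffun i => u 0 i]) => [f _|u _].
  by apply/ffunP => i; rewrite ffunE mxE.
by apply/rowP => i; rewrite mxE ffunE.
Qed.

Lemma sum_block_chan_input y :
  \sum_u block_chan u y = #|{: 'rV[F]_L}|%:R * block_out y.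
Proof.
rewrite /block_chan (sum_row_prod (fun i x => W x (y i))).
rewrite card_mx mul1n natrX -[X in _ ^+ X]card_ord -prodr_const -big_split/=.
apply: eq_bigr => i _; rewrite /unif_out mulrA mulfV ?mul1r//.
by rewrite pnatr_eq0 -lt0n; apply/card_gt0P; exists 0.
Qed.

(** Chernoff bound: on an unlikely output of positive probability the densities add up to at most
    [l], so the weight [exp (s (l - sum))] is at least 1. *)
Lemma sum_unlikely (s m : R) u : 0 <= s ->
  (forall x, \sum_b W x b * expR (- s * info_density W x b) <= m) ->
  \sum_y (~~ likely u y)%:R * block_chan u y <= expR (s * l) * m ^+ L.
Proof.
move=> s0 hm.
apply: (@le_trans _ _ (\sum_(y : {ffun 'I_L -> Y}) expR (s * l) *
  \prod_i (W (u 0 i) (y i) * expR (- s * info_density W (u 0 i) (y i))))); last first.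
  rewrite -mulr_sumr; apply: ler_wpM2l; first exact: expR_ge0.
  rewrite -(bigA_distr_bigA (fun i b => W (u 0 i) b *
    expR (- s * info_density W (u 0 i) b))).
  rewrite -[X in _ ^+ X]card_ord -prodr_const; apply: ler_prod => i _.
  rewrite hm andbT; apply: sumr_ge0 => b _; apply: mulr_ge0 => //.
  exact: expR_ge0.
apply: ler_sum => y _.
have R0 : 0 <= expR (s * l) *
  \prod_i (W (u 0 i) (y i) * expR (- s * info_density W (u 0 i) (y i))).
  apply: mulr_ge0; first exact: expR_ge0.
  by apply: prodr_ge0 => i _; apply: mulr_ge0 => //; exact: expR_ge0.
have [|nl] := boolP (likely u y); first by rewrite mul0r.
rewrite mul1r; have [->//|Wn0] := eqVneq (block_chan u y) 0.
have Wpos i : 0 < W (u 0 i) (y i).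
  rewrite lt_neqAle W_ge0 eq_sym andbT.
  by move/prodf_neq0: Wn0 => /(_ i isT).
have Qpos : 0 < block_out y.
  by apply: prodr_gt0 => i _; exact: (unif_out_gt0 0 dmcW (Wpos i)).
rewrite big_split/= -expR_sum mulrCA -expRD ler_peMr ?block_chan_ge0//.
rewrite -[leLHS]expR0 ler_expR -mulr_sumr mulNr -mulrBr mulr_ge0// subr_ge0.
rewrite -ler_expR expR_sum.
rewrite (eq_bigr (fun i => W (u 0 i) (y i) / unif_out W (y i))); last first.
  by move=> i _; exact: (expR_info_density 0 dmcW).
by rewrite prodf_div ler_pdivrMr// leNgt.
Qed.

(** Passing the test gives [block_out y < exp (- l) * block_chan u y], so a codeword independent of
    the output passes with probability at most [exp (- l)]. *)
Lemma sum_likely_out :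
  \sum_u \sum_y (likely u y)%:R * block_out y <=
  expR (- l) * #|{: 'rV[F]_L}|%:R.
Proof.
rewrite -[X in _ * X%:R]sum1_card natr_sum mulr_sumr; apply: ler_sum => u _.
rewrite [leRHS](_ : _ = \sum_y expR (- l) * block_chan u y); last first.
  by rewrite -mulr_sumr sum_block_chan.
apply: ler_sum => y _; case: (boolP (likely u y)) => [h|_]; last first.
  by rewrite mul0r mulr_ge0 ?expR_ge0 ?block_chan_ge0.
by rewrite mul1r expRN -ler_pdivrMl ?invr_gt0 ?expR_gt0// invrK ltW.
Qed.

Variable k : nat.
Local Notation generator := ('M[F]_(k, L) * 'rV[F]_L)%type.

(** Distinct messages have independent uniform codewords: a shift of the matrix moves their
    difference at will, and a shift of the offset then adjusts the first one. *)
Lemma codeword_pair_uniform (x x' : 'rV[F]_k) (h : 'rV[F]_L * 'rV[F]_L -> R) :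
  x != x' ->
  #|{: 'rV[F]_L * 'rV[F]_L}|%:R *
    \sum_(g : generator) h (x *m g.1 + g.2, x' *m g.1 + g.2) =
  #|{: generator}|%:R * \sum_p h p.
Proof.
move=> xx'; apply: sum_equal_fibers => -[b1 b2] [c1 c2].
have [j zj] : exists j, (x' - x) 0 j != 0.
  by apply/rV0Pn; rewrite subr_eq0 eq_sym.
pose w := (c2 - b2) - (c1 - b1).
(* Only row [j], where [x' - x] is nonzero, is filled, which solves [(x' - x) *m G0 = w]. *)
pose G0 := \matrix_(i < k, i' < L)
  if i == j then ((x' - x) 0 j)^-1 * w 0 i' else 0 : F.
have zG : (x' - x) *m G0 = w.
  apply/rowP => i'; rewrite !mxE (bigD1 j)//= big1 => [|i ij]; last first.
    by rewrite [X in _ * X]mxE (negbTE ij) mulr0.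
  rewrite [X in _ * X]mxE eqxx addr0 mulrA mulfV// mul1r.
  by rewrite !mxE.
exists (fun g => (g.1 + G0, g.2 + (c1 - b1 - x *m G0))).
  by move=> [G a] [G' a'] /= [/addIr -> /addIr ->].
move=> [G a] /= [hb1 hb2].
have zG' : x' *m G0 = w + x *m G0 by rewrite -zG mulmxBl subrK.
rewrite !mulmxDr zG' /w -hb1 -hb2.
by congr (_, _); apply/rowP => i; rewrite !mxE; ring.
Qed.

(** The default 0 is harmless: if no message passes, the sent codeword is itself unlikely, an event
    already charged. *)
Definition threshold_decoder (g : generator) y : 'rV[F]_k :=
  odflt 0 [pick x | likely (x *m g.1 + g.2) y].

Lemma threshold_decoder_error (g : generator) x y :
  (threshold_decoder g y != x)%:R * block_chan (x *m g.1 + g.2) y <=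
  (~~ likely (x *m g.1 + g.2) y)%:R * block_chan (x *m g.1 + g.2) y +
  \sum_(x' | x != x') (likely (x' *m g.1 + g.2) y)%:R *
     block_chan (x *m g.1 + g.2) y.
Proof.
rewrite -mulr_suml -mulrDl; apply: ler_wpM2r; first exact: block_chan_ge0.
have s0 (P : pred 'rV[F]_k) :
    0 <= \sum_(x' | P x') (likely (x' *m g.1 + g.2) y)%:R :> R.
  by apply: sumr_ge0 => x' _; exact: ler0n.
case: (boolP (likely _ y)) => [xl|_]; last first.
  by rewrite (le_trans (_ : _ <= 1))// ?lern1 ?leq_b1// lerDl.
rewrite add0r; have [|bad] := eqVneq (threshold_decoder g y) x; first by [].
move: bad; rewrite /threshold_decoder; case: pickP => [x1 x1l|/(_ x)]; last first.
  by rewrite xl.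
by rewrite /= => x1x; rewrite (bigD1 x1) 1?eq_sym//= x1l lerDl.
Qed.

(** Averaged over all generators, rejection of the sent codeword obeys the Chernoff bound, and
    pairwise uniformity bounds each false acceptance by [exp (- l)]. *)
Lemma good_generator (s m : R) : 0 <= s ->
  (forall x, \sum_b W x b * expR (- s * info_density W x b) <= m) ->
  exists g : generator,
    \sum_x \sum_y (threshold_decoder g y != x)%:R * block_chan (x *m g.1 + g.2) y
    <= #|{: 'rV[F]_k}|%:R *
       (expR (s * l) * m ^+ L + (#|{: 'rV[F]_k}|%:R - 1) * expR (- l)).
Proof.
move=> s0 hm; apply: exists_le_average.
  by apply/card_gt0P; exists (0, 0).
apply: (@le_trans _ _ (\sum_(g : generator) \sum_x
   (expR (s * l) * m ^+ L + \sum_(x' | x != x') \sum_y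
     (likely (x' *m g.1 + g.2) y)%:R * block_chan (x *m g.1 + g.2) y))).
  apply: ler_sum => g _; apply: ler_sum => x _.
  apply: (le_trans (ler_sum _ (fun y _ => threshold_decoder_error g x y))).
  rewrite big_split/=; apply: lerD; first exact: sum_unlikely.
  by rewrite exchange_big.
rewrite exchange_big/= mulrCA -[X in X%:R * _]sum1_card natr_sum mulr_suml.
apply: ler_sum => x _; rewrite mul1r big_split/= sumr_const.
rewrite -(mulr_natl (expR (s * l) * _)) mulrDr lerD2l exchange_big/=.
have -> : #|{: 'rV[F]_k}|%:R - 1 = \sum_(x' : 'rV[F]_k | x != x') 1 :> R.
  have -> : #|{: 'rV[F]_k}|%:R = \sum_(x' : 'rV[F]_k) 1 :> R.
    by rewrite sumr_const.
  rewrite (bigD1 x)//= [1 + _]addrC addrK.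
  by apply: eq_bigl => x'; rewrite eq_sym.
rewrite mulr_suml mulr_sumr; apply: ler_sum => x' xx'; rewrite mul1r.
have c0 : 0 < #|{: 'rV[F]_L * 'rV[F]_L}|%:R :> R.
  by rewrite ltr0n; apply/card_gt0P; exists (0, 0).
rewrite -(ler_pM2l c0).
rewrite (codeword_pair_uniform (fun p => \sum_y (likely p.2 y)%:R * block_chan p.1 y) xx').
rewrite mulrCA; apply: ler_wpM2l => //.
rewrite -(pair_bigA _ (fun u u' => \sum_y (likely u' y)%:R * block_chan u y))/=.
rewrite exchange_big/=.
rewrite (eq_bigr (fun u' => #|{: 'rV[F]_L}|%:R *
    \sum_y (likely u' y)%:R * block_out y)); last first.
  move=> u' _; rewrite exchange_big mulr_sumr; apply: eq_bigr => y _.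
  by rewrite -mulr_sumr sum_block_chan_input mulrCA.
rewrite -mulr_sumr card_prod natrM -mulrA; apply: ler_wpM2l => //.
by rewrite mulrC; exact: sum_likely_out.
Qed.

End FixedLength.

Lemma affine_code (delta eps : R) : 0 < delta -> 0 < eps ->
  exists L0, forall L, (L0 <= L)%N ->
  exists k (g : 'M[F]_(k, L) * 'rV[F]_L) (dec : {ffun 'I_L -> Y} -> 'rV[F]_k),
    expR (L%:R * (unif_info W - delta)) <= #|{: 'rV[F]_k}|%:R /\
    \sum_x \sum_y (dec y != x)%:R * block_chan (x *m g.1 + g.2) y
      <= eps * #|{: 'rV[F]_k}|%:R.
Proof.
move=> d0 e0; pose d1 := delta / 4; have d10 : 0 < d1 by rewrite divr_gt0.
have [s s0 hs] := mgf_info_density (0 : F) dmcW symW d10.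
have e20 : 0 < eps / 2 by rewrite divr_gt0.
have [L1 h1] := expR_decay 0 (mulr_gt0 s0 d10) e20.
have [L2 h2] := expR_decay 0 d10 e20.
have [L3 h3] := expR_decay (ln #|F|%:R) d10 (ltr01 : 0 < 1 :> R).
exists (maxn L1 (maxn L2 L3)) => L; rewrite !geq_max => /and3P[/h1{}h1 /h2{}h2 /h3{}h3].
have q1 : (1 < #|F|)%N by exact: card_finNzRing_gt1.
(* The four quarters of [delta] pay for the moment bound, the rejection of the sent codeword, the
   false acceptances and the rounding to a power of [#|F|]. *)
pose l := L%:R * (unif_info W - 2 * d1).
pose T := L%:R * (unif_info W - 3 * d1).
(* The successor keeps [z] positive when [T] is negative, and [#|F| ^ k - 1] stays below [exp T]. *)
pose z := (Num.truncn (expR T)).+1; pose k := trunc_log #|F| z.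
have [g hg] := @good_generator L l k s _ (ltW s0)
  (fun x => (hs s (introT andP (conj s0 (lexx s))) x).2).
exists k, g, (threshold_decoder l g); split.
  rewrite card_mx mul1n.
  have q0 : 0 < #|F|%:R :> R by rewrite ltr0n ltnW.
  have h : expR T <= #|F|%:R * (#|F| ^ k)%:R.
    apply: le_trans (ltW (truncnS_gt _)) _.
    by rewrite -natrM -expnS ler_nat ltnW// trunc_log_ltn.
  rewrite -(ler_pM2l q0); apply: le_trans h.
  rewrite -[X in X * _]lnK ?posrE// -expRD ler_expR.
  move: h3; rewrite -[X in _ <= X]expR0 ler_expR /T /d1; lra.
apply: le_trans hg _; rewrite mulrC; apply: ler_wpM2r => //.
have -> : eps = eps / 2 + eps / 2 by field.
apply: lerD.
  rewrite -expRM_natl -expRD; apply: le_trans h1; rewrite ler_expR /l; lra.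
have qk : #|{: 'rV[F]_k}|%:R - 1 <= expR T.
  rewrite card_mx mul1n lerBlDr.
  have : (#|F| ^ k <= z)%N by rewrite trunc_logP.
  rewrite -(ler_nat R) => /le_trans; apply; rewrite /z -natr1 lerD2r.
  by rewrite truncn_le expR_ge0.
apply: le_trans (ler_wpM2r (expR_ge0 _) qk) _.
rewrite -expRD; apply: le_trans h2; rewrite ler_expR /T /l; lra.
Qed.

End AffineCode.

(** * Random relay maps *)

Section RandomRelaying.
Variables (R : realType) (n : nat) (F : 'I_n -> finFieldType).
Variables (e : rel (node n)) (beta : forall (u : node n) (v : 'I_n), F v).
Variable D : {set 'I_n}.
Hypothesis hbeta : forall u v, e u (Some v) -> beta u v != 0.
Variables (k : 'I_n -> nat) (M : nat).
Local Notation A v := 'rV[F v]_(k v).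

Lemma card_row_gt0 v : 0 < #|{: A v}|%:R :> R.
Proof. by rewrite ltr0n; apply/card_gt0P; exists 0. Qed.

(** * One block: random codebooks and the potential *)

Section OneStep.
Variable St : finType.
Local Notation codebook := {dffun forall v : 'I_n, {ffun St -> A v}}.

(** What [v] is to decode; [key u m] stands for all that [u] knows under [m]. As distinct nodes
    never share a state, one random [f] gives them independent messages. *)
Definition combine v (f : {ffun St -> A v}) (key : node n -> 'I_M -> St) m : A v :=
  \sum_(u | e u (Some v)) beta u v *: f (key u m).

Lemma codeword_shift_uniform v (phi : {ffun St -> A v} -> A v) (x0 : St)
    (c : F v) (h : A v -> R) :
  c != 0 ->
  (forall (f : {ffun St -> A v}) (w : A v),
    phi [ffun x => f x + if x == x0 then w else 0] = phi f + c *: w) ->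
  #|{: A v}|%:R * \sum_f h (phi f) = #|{: {ffun St -> A v}}|%:R * \sum_x h x.
Proof.
move=> c0 hphi; apply: sum_equal_fibers => b b'.
exists (fun f : {ffun St -> A v} =>
  [ffun x => f x + if x == x0 then c^-1 *: (b' - b) else 0] : {ffun St -> A v}).
  move=> f f' /ffunP ff'; apply/ffunP => x; move: (ff' x); rewrite !ffunE.
  exact: addIr.
by move=> f fb; rewrite hphi fb scalerA mulfV// scale1r addrC subrK.
Qed.

Variable key : node n -> 'I_M -> St.
Hypothesis key_node : forall u u' m m', key u m = key u' m' -> u = u'.

Lemma combine_shift v (f : {ffun St -> A v}) u0 m0 m w : e u0 (Some v) ->
  combine [ffun x => f x + if x == key u0 m0 then w else 0] key m =
  combine f key m + (if key u0 m == key u0 m0 then beta u0 v else 0) *: w.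
Proof.
move=> eu0; rewrite /combine.
under eq_bigr do rewrite ffunE scalerDr.
rewrite big_split/=; congr (_ + _).
rewrite (bigD1 u0)//= big1 => [|u /andP[_ uu0]]; last first.
  case: eqP => [/key_node uE|_]; last by rewrite scaler0.
  by rewrite uE eqxx in uu0.
by rewrite addr0; case: ifP => _; rewrite ?scaler0 ?scale0r.
Qed.

Lemma sum_combine v u0 m (h : A v -> R) : e u0 (Some v) ->
  #|{: A v}|%:R * \sum_(f : {ffun St -> A v}) h (combine f key m) =
  #|{: {ffun St -> A v}}|%:R * \sum_x h x.
Proof.
move=> eu0; apply: (@codeword_shift_uniform v (fun f => combine f key m) (key u0 m) _ h
  (hbeta eu0)) => f w.
by rewrite combine_shift// eqxx.
Qed.

(** A shift of [f] at [key u0 m] moves only the first combination, so the difference of the two is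
    uniform. *)
Lemma sum_combine_collision v u0 m m' : e u0 (Some v) -> key u0 m != key u0 m' ->
  #|{: A v}|%:R * \sum_(f : {ffun St -> A v})
      (combine f key m == combine f key m')%:R =
  #|{: {ffun St -> A v}}|%:R :> R.
Proof.
move=> eu0 kne.
have := @codeword_shift_uniform v (fun f => combine f key m - combine f key m')
  (key u0 m) _ (fun x => (x == 0)%:R) (hbeta eu0).
under eq_bigr do rewrite subr_eq0; move=> ->.
  rewrite (bigD1 0)//= eqxx big1 ?addr0 ?mulr1// => x /negbTE -> //.
move=> f w; rewrite !combine_shift// eqxx eq_sym (negbTE kne) scale0r addr0.
by rewrite addrAC.
Qed.

Lemma card_codebook : #|{: codebook}|%:R = \prod_v #|{: {ffun St -> A v}}|%:R :> R.
Proof.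
transitivity (\sum_(cb : codebook) (1 : R)); first by rewrite sumr_const.
transitivity (\prod_v \sum_(f : {ffun St -> A v}) (1 : R)); last first.
  by apply: eq_bigr => v _; rewrite sumr_const.
rewrite -(sum_dffun_prod (fun v (_ : {ffun St -> A v}) => 1 : R)).
by apply: eq_bigr => cb _; rewrite big1.
Qed.

Lemma sum_codebook_node v0 (g : forall v, {ffun St -> A v} -> R) (c : R) :
  \sum_f g v0 f <= #|{: {ffun St -> A v0}}|%:R * c ->
  \sum_(cb : codebook) g v0 (cb v0) <= #|{: codebook}|%:R * c.
Proof.
move=> hg; rewrite (eq_bigr (fun cb : codebook =>
    \prod_v (if v == v0 then g v (cb v) else 1))); last first.
  move=> cb _; rewrite (bigD1 v0)//= eqxx big1 ?mulr1// => v /negbTE -> //.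
rewrite (sum_dffun_prod (fun v f => if v == v0 then g v f else 1)).
rewrite card_codebook (bigD1 v0)//= [X in _ <= X * _](bigD1 v0)//= eqxx mulrAC.
rewrite [X in _ * X <= _](_ : _ = \prod_(v | v != v0) #|{: {ffun St -> A v}}|%:R).
  by apply: ler_wpM2r => //; apply: prodr_ge0.
by apply: eq_bigr => v /negbTE ->; rewrite sumr_const.
Qed.

Variables (err : forall v, A v -> R) (eps : R).
Hypothesis err_ge0 : forall v x, 0 <= err (x : A v).
Hypothesis err_avg : forall v, \sum_x err (x : A v) <= eps * #|{: A v}|%:R.
Hypothesis isolated : forall v, ~~ [exists u, e u (Some v)] -> k v = 0%N.

(** A uniform combination turns the expected error into the average error of the code; a node
    without in-neighbours has a single message, where both agree. *)
Lemma sum_codebook_err v m :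
  \sum_(cb : codebook) err (combine (cb v) key m) <= #|{: codebook}|%:R * eps.
Proof.
apply: (@sum_codebook_node v (fun v f => err (combine f key m))).
have [/existsP[u0 eu0]|/isolated kv] := boolP [exists u, e u (Some v)].
  rewrite -(ler_pM2l (card_row_gt0 v)) (sum_combine _ _ eu0) mulrCA.
  by apply: ler_wpM2l => //; rewrite mulrC.
have c1 : #|{: A v}| = 1%N by rewrite card_mx kv muln0.
rewrite mulr_natl -sumr_const; apply: ler_sum => f _.
have := err_avg v; rewrite c1 mulr1; apply: le_trans.
by rewrite (bigD1 (combine f key m))//= lerDl sumr_ge0.
Qed.

Definition knows m m' : {set node n} := [set u | key u m != key u m'].

(** Functions of distinct receivers are independent, and each boundary node has an in-neighbour that
    separates the two messages. *)
Lemma sum_codebook_collision m m' :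
  \sum_(cb : codebook) \prod_(v in cut_boundary e (knows m m'))
     (combine (cb v) key m == combine (cb v) key m')%:R =
  #|{: codebook}|%:R *
     \prod_(v in cut_boundary e (knows m m')) #|{: A v}|%:R^-1 :> R.
Proof.
set Bd := cut_boundary e _.
transitivity (\sum_(cb : codebook) \prod_v (if v \in Bd then
    (combine (cb v) key m == combine (cb v) key m')%:R else 1) : R).
  by apply: eq_bigr => cb _; rewrite [LHS]big_mkcond.
rewrite (sum_dffun_prod (fun v f => if v \in Bd then
  (combine f key m == combine f key m')%:R else 1)).
rewrite card_codebook [X in _ * X]big_mkcond -big_split/=.
apply: eq_bigr => v _; case: ifPn => [|_]; last by rewrite sumr_const mulr1.
rewrite inE => /andP[_ /existsP[u /andP[]]]; rewrite inE => kne eu.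
rewrite -(sum_combine_collision eu kne) mulrAC mulfV ?mul1r//.
by rewrite gt_eqF// card_row_gt0.
Qed.

Variable a : R.
Hypotheses (a_gt0 : 0 < a) (a_le1 : a <= 1).
Hypothesis cut_le : forall S : {set node n}, is_cut D S ->
  \prod_(v in cut_boundary e S) #|{: A v}|%:R^-1 <= a.

Definition relay_knows m m' : {set 'I_n} :=
  [set v | key (Some v) m != key (Some v) m'].

Definition next_relay_knows (cb : codebook) m m' : {set 'I_n} :=
  relay_knows m m' :|: [set v | combine (cb v) key m != combine (cb v) key m'].

(* Either no relay learns anything new, which forces a collision at every
   node of the boundary of a cut and so has probability at most [a], or the
   exponent [#|S|] grows and a factor [a] is gained for free. *)
Lemma potential_step m m' d : key None m != key None m' -> d \in D ->
  \sum_(cb : codebook) a ^+ #|next_relay_knows cb m m'| *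
      (d \notin next_relay_knows cb m m')%:R <=
  #|{: codebook}|%:R *
    (2 * a * (a ^+ #|relay_knows m m'| * (d \notin relay_knows m m')%:R)).
Proof.
move=> kN dD; set S := relay_knows m m'; have a0 := ltW a_gt0.
have SS cb : S \subset next_relay_knows cb m m' by exact: finset.subsetUl.
have [dS|dS] := boolP (d \in S).
  rewrite big1 ?mulr0// => cb _.
  by rewrite (fintype.subsetP (SS cb) _ dS) mulr0.
have Scut : is_cut D (knows m m').
  rewrite /is_cut inE kN/=; apply/existsP; exists d; rewrite dD/=.
  by move: dS; rewrite !inE.
pose coll (cb : codebook) : R := \prod_(v in cut_boundary e (knows m m'))
  (combine (cb v) key m == combine (cb v) key m')%:R.
have coll0 cb : 0 <= coll cb by apply: prodr_ge0 => v _; exact: ler0n.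
apply: (@le_trans _ _ (\sum_(cb : codebook) a ^+ #|S| * (coll cb + a))).
  apply: ler_sum => cb _; set S' := next_relay_knows cb m m'.
  apply: (@le_trans _ _ (a ^+ #|S'|)).
    by apply: ler_piMr; rewrite ?exprn_ge0// lern1 leq_b1.
  have [SE|SE] := eqVneq S S'; last first.
    apply: (@le_trans _ _ (a ^+ #|S|.+1)).
      apply: ler_wiXn2l => //; apply: proper_card.
      by rewrite finset.properEneq SE SS.
    rewrite exprSr; apply: ler_wpM2l; rewrite ?exprn_ge0// lerDr.
    exact: coll0.
  rewrite -SE; apply: ler_peMr; rewrite ?exprn_ge0//.
  rewrite /coll big1 ?lerDl// => v; rewrite !inE negbK => /andP[kv _].
  have : v \notin S' by rewrite -SE !inE kv.
  by rewrite !inE negb_or !negbK => /andP[_ ->].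
rewrite -mulr_sumr big_split/= sumr_const sum_codebook_collision mulr1.
rewrite -[X in _ + X]mulr_natl -mulrDr mulrCA; apply: ler_wpM2l => //.
rewrite mulrC; apply: ler_wpM2r; first by rewrite exprn_ge0.
by rewrite (_ : 2 * a = a + a) ?lerD2r ?cut_le//; ring.
Qed.

Definition pair_sum (f : 'I_M -> 'I_M -> 'I_n -> R) : R :=
  \sum_m \sum_(m' | m' != m) \sum_(d in D) f m m' d.

(** The weighted potential and the errors are averaged as one sum, so that a single codebook
    controls both. *)
Lemma exists_codebook (omega : R) : 0 <= omega ->
  (forall m m', m' != m -> key None m != key None m') ->
  exists cb : codebook,
    omega * pair_sum (fun m m' d => a ^+ #|next_relay_knows cb m m'| *
        (d \notin next_relay_knows cb m m')%:R) +
      \sum_m \sum_v err (combine (cb v) key m) <=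
    omega * (2 * a) * pair_sum (fun m m' d => a ^+ #|relay_knows m m'| *
        (d \notin relay_knows m m')%:R) + M%:R * (n%:R * eps).
Proof.
move=> om0 kN; apply: exists_le_average.
  by apply/card_gt0P; exists (finfun (fun v => 0)).
rewrite big_split/= mulrDr; apply: lerD.
  rewrite -mulr_sumr.
  rewrite [leRHS](_ : _ = omega * (#|{: codebook}|%:R * (2 * a *
    pair_sum (fun m m' d => a ^+ #|relay_knows m m'| *
        (d \notin relay_knows m m')%:R)))); last by ring.
  apply: ler_wpM2l => //; rewrite /pair_sum exchange_big/= !mulr_sumr.
  apply: ler_sum => m _; rewrite exchange_big/= !mulr_sumr.
  apply: ler_sum => m' mm'; rewrite exchange_big/= !mulr_sumr.
  by apply: ler_sum => d dD; apply: potential_step => //; exact: kN.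
rewrite exchange_big/=.
have -> : #|{: codebook}|%:R * (M%:R * (n%:R * eps)) =
    \sum_(m < M) \sum_(v < n) #|{: codebook}|%:R * eps.
  rewrite sumr_const card_ord sumr_const card_ord.
  by rewrite -(mulr_natl (_ *+ _)) -(mulr_natl (_ * eps)); ring.
apply: ler_sum => m _; rewrite exchange_big/=; apply: ler_sum => v _.
exact: sum_codebook_err.
Qed.

End OneStep.

(** * Choosing the relay maps block by block *)

Section Iteration.
Variable B : nat.

Definition state_type (u : node n) : finType :=
  if u is Some v then {ffun 'I_B -> A v} : finType else 'I_M : finType.
(** The tag names the node, so different nodes never share a state. *)
Definition state : finType := {u : node n & state_type u}.
Definition history : Type := forall v, 'I_M -> {ffun 'I_B -> A v}.
Local Notation codebook := {dffun forall v : 'I_n, {ffun state -> A v}}.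

Definition state_of (h : history) (u : node n) (m : 'I_M) : state :=
  match u with
  | Some v => existT state_type (Some v) (h v m)
  | None => existT state_type None m
  end.

(** Records have fixed length [B], hence a state type independent of time; blocks not yet decoded
    read 0. *)
Definition mask (b : nat) v (f : {ffun 'I_B -> A v}) : {ffun 'I_B -> A v} :=
  [ffun j : 'I_B => if (j < b)%N then f j else 0].

Lemma state_of_node h u u' m m' : state_of h u m = state_of h u' m' -> u = u'.
Proof. by case: u u' => [u|] [u'|] //= /(congr1 tag). Qed.

Lemma state_of_relay h v m m' :
  (state_of h (Some v) m != state_of h (Some v) m') = (h v m != h v m').
Proof. by rewrite /= eq_sym eq_Tagged/= eq_sym. Qed.

Lemma state_of_source h m m' :
  (state_of h None m != state_of h None m') = (m != m').
Proof. by rewrite /= eq_sym eq_Tagged/= eq_sym. Qed.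

Variables (err : forall v, A v -> R) (eps a : R).
Hypothesis err_ge0 : forall v x, 0 <= err (x : A v).
Hypothesis err_avg : forall v, \sum_x err (x : A v) <= eps * #|{: A v}|%:R.
Hypothesis isolated : forall v, ~~ [exists u, e u (Some v)] -> k v = 0%N.
Hypotheses (a_gt0 : 0 < a) (a_le1 : a <= 1).
Hypothesis cut_le : forall S : {set node n}, is_cut D S ->
  \prod_(v in cut_boundary e S) #|{: A v}|%:R^-1 <= a.

(** Weighting the potential after block [b] by [(2 a) ^ (B - b.+1)] makes the factors telescope. The
    extra [(a ^ n)^-1] turns the final potential into a bound on unseparated pairs, since at most
    [n] relays can separate them. *)
Lemma exists_relay_maps :
  exists (cb : nat -> codebook) (X : history),
    (forall v m (b : 'I_B), X v m b =
       combine (cb b v) (state_of (fun v m => mask b (X v m))) m) /\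
    pair_sum (fun m m' d => (X d m == X d m')%:R) +
      \sum_(b < B) \sum_m \sum_v err (X v m b) <=
    (a ^+ n)^-1 * (2 * a) ^+ B * (M%:R * (M%:R - 1) * #|D|%:R)
      + B%:R * (M%:R * (n%:R * eps)).
Proof.
have a0 := ltW a_gt0.
pose S (h : history) m m' : {set 'I_n} := [set v | h v m != h v m'].
pose Phi h := pair_sum (fun m m' d => a ^+ #|S h m m'| * (d \notin S h m m')%:R).
have SE h m m' : relay_knows (state_of h) m m' = S h m m'.
  by apply/setP => v; rewrite !inE state_of_relay.
have /choice[next hnext] : forall p : {w : R | 0 <= w} * history,
    exists cb : codebook,
    val p.1 * pair_sum (fun m m' d =>
        a ^+ #|next_relay_knows (state_of p.2) cb m m'| *
        (d \notin next_relay_knows (state_of p.2) cb m m')%:R) +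
      \sum_m \sum_v err (combine (cb v) (state_of p.2) m) <=
    val p.1 * (2 * a) * Phi p.2 + M%:R * (n%:R * eps).
  move=> [[w w0] h] /=.
  have [|cb] := @exists_codebook state (state_of h) (@state_of_node h) err eps
    err_ge0 err_avg isolated a a_gt0 a_le1 cut_le w w0.
    by move=> m m'; rewrite eq_sym state_of_source.
  move=> hcb; exists cb; apply: le_trans hcb _; rewrite /Phi /pair_sum.
  rewrite le_eqVlt; apply/orP; left; apply/eqP; congr (_ * _ + _).
  by apply: eq_bigr => m _; apply: eq_bigr => m' _; apply: eq_bigr => d _; rewrite SE.
have w0 b : 0 <= (a ^+ n)^-1 * (2 * a) ^+ (B - b.+1).
  by rewrite mulr_ge0 ?invr_ge0 ?exprn_ge0// mulr_ge0.
pose w b : {w : R | 0 <= w} := exist (fun w => 0 <= w) _ (w0 b).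
pose hist := fix hist b : history := if b is b'.+1 then
    fun v m => [ffun j : 'I_B => if j == b' :> nat
      then combine (next (w b', hist b') v) (state_of (hist b')) m
      else hist b' v m j]
  else fun v m => [ffun => 0].
pose cb b := next (w b, hist b).
have histS b v m : hist b.+1 v m = [ffun j : 'I_B => if j == b :> nat
   then combine (cb b v) (state_of (hist b)) m else hist b v m j] by [].
have hist0 b v m (j : 'I_B) : (b <= j)%N -> hist b v m j = 0.
  elim: b => [|b IH] bj; first by rewrite ffunE.
  by rewrite histS ffunE gtn_eqF// IH// ltnW.
have histK b c v m (j : 'I_B) : (j < b)%N -> (b <= c)%N ->
    hist c v m j = hist b v m j.
  move=> jb; elim: c => [|c IH]; first by rewrite leqn0 => /eqP b0; rewrite b0 in jb.
  rewrite leq_eqVlt => /predU1P[->//|]; rewrite ltnS => bc.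
  by rewrite histS ffunE ltn_eqF ?IH// (leq_trans jb).
pose X := hist B.
(* Entries from [b] on are still 0 in [hist b], so it is the truncation of the final history. *)
have histE b : (b <= B)%N -> hist b = fun v m => mask b (X v m).
  move=> bB; apply: functional_extensionality_dep => v.
  apply: functional_extensionality_dep => m; apply/ffunP => j.
  rewrite ffunE; case: ltnP => jb; last exact: hist0.
  by rewrite /X (histK b).
have XE v m (b : 'I_B) : X v m b =
    combine (cb b v) (state_of (fun v m => mask b (X v m))) m.
  rewrite -histE; last exact: ltnW.
  by rewrite /X (histK b.+1)// histS ffunE eqxx.
exists cb, X; split=> //.
have SS b m m' : (b < B)%N ->
    S (hist b.+1) m m' = next_relay_knows (state_of (hist b)) (cb b) m m'.
  move=> bB; apply/setP => v; rewrite !inE state_of_relay.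
  rewrite -negb_and; congr (~~ _); apply/eqP/andP => [/ffunP h|[/eqP h /eqP h']].
    split; apply/eqP; last by have := h (Ordinal bB); rewrite !histS !ffunE eqxx.
    apply/ffunP => j; have [jb|jb] := ltnP j b.
      by have := h j; rewrite !histS !ffunE ltn_eqF.
    by rewrite !hist0.
  by rewrite !histS; apply/ffunP => j; rewrite !ffunE h h'.
pose Err b := \sum_m \sum_v err (combine (cb b v) (state_of (hist b)) m).
have J b : (b <= B)%N ->
    (a ^+ n)^-1 * (2 * a) ^+ (B - b) * Phi (hist b) +
      \sum_(j < b) Err j <=
    (a ^+ n)^-1 * (2 * a) ^+ B * Phi (hist 0) + b%:R * (M%:R * (n%:R * eps)).
  elim: b => [|b IH] bB; first by rewrite subn0 big_ord0 mul0r.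
  have {}IH := IH (ltnW bB).
  have := hnext (w b, hist b); rewrite /= -/(cb b) => hn.
  have PhiS : pair_sum (fun m m' d =>
      a ^+ #|next_relay_knows (state_of (hist b)) (cb b) m m'| *
      (d \notin next_relay_knows (state_of (hist b)) (cb b) m m')%:R) =
    Phi (hist b.+1).
    by apply: eq_bigr => m _; apply: eq_bigr => m' _; apply: eq_bigr => d _; rewrite SS.
  rewrite PhiS in hn.
  have wS : (a ^+ n)^-1 * (2 * a) ^+ (B - b.+1) * (2 * a) =
      (a ^+ n)^-1 * (2 * a) ^+ (B - b) by rewrite -mulrA -exprSr subnSK.
  rewrite wS in hn.
  rewrite -/(Err b) in hn.
  have ES : \sum_(j < b.+1) Err j = \sum_(j < b) Err j + Err b.
    by rewrite big_ord_recr.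
  have bS c : b.+1%:R * c = b%:R * c + c :> R by rewrite -natr1 mulrDl mul1r.
  rewrite ES bS; move: IH hn; lra.
have := J B (leqnn B); rewrite subnn expr0 mulr1.
have -> : \sum_(j < B) Err j =
    \sum_(b < B) \sum_m \sum_v err (X v m b).
  apply: eq_bigr => b _; apply: eq_bigr => m _; apply: eq_bigr => v _.
  by rewrite XE histE// ltnW.
have -> : Phi (hist 0) = M%:R * (M%:R - 1) * #|D|%:R.
  rewrite /Phi /pair_sum.
  have S0 m m' : S (hist 0) m m' = finset.set0.
    by apply/setP => v; rewrite !inE eqxx.
  transitivity (\sum_(m < M) \sum_(m' < M | m' != m) (#|D|%:R : R)).
    apply: eq_bigr => m _; apply: eq_bigr => m' _; rewrite -[in RHS]sum1_card natr_sum.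
    by apply: eq_bigr => d _; rewrite S0 cards0 expr0 inE mulr1.
  transitivity (\sum_(m < M) ((M%:R - 1) * #|D|%:R : R)); last first.
    by rewrite sumr_const card_ord -(mulr_natl (_ * _)) mulrA.
  apply: eq_bigr => m _.
  have : \sum_(m' < M) (#|D|%:R : R) = M%:R * #|D|%:R.
    by rewrite sumr_const card_ord mulr_natl.
  rewrite (bigD1 m)//= => h; rewrite mulrBl mul1r -h; ring.
apply: le_trans; rewrite lerD2r /Phi /pair_sum mulr_sumr.
apply: ler_sum => m _; rewrite mulr_sumr; apply: ler_sum => m' _.
rewrite mulr_sumr; apply: ler_sum => d _; rewrite mulrA inE negbK -/X.
apply: ler_peMl => //; rewrite mulrC ler_pdivlMr ?exprn_gt0// mul1r.
apply: ler_wiXn2l => //; by rewrite -[leqRHS]card_ord max_card.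
Qed.

End Iteration.

End RandomRelaying.

(** * Achievability *)

Section BlockCode.
Variables (R : realType) (n : nat) (F : 'I_n -> finFieldType).
Variables (Y : 'I_n -> finType) (W : forall v : 'I_n, F v -> Y v -> R).
Variables (e : rel (node n)) (beta : forall (u : node n) (v : 'I_n), F v).
Variable D : {set 'I_n}.
Arguments W : clear implicits.
Hypotheses (hbeta : forall u v, e u (Some v) -> beta u v != 0).
Hypotheses (hdmc : forall v, is_dmc (W v)).
Hypotheses (hsym : forall v, gallager_symmetric (W v)).

(* A code from which node [v] decodes the combination of its neighbours'
   messages, never the individual messages. *)
Record comp_code (v : 'I_n) (L : nat) := CompCode {
  cc_dim : nat;
  cc_enc : node n -> 'rV[F v]_cc_dim -> 'rV[F v]_L;
  cc_word : 'rV[F v]_cc_dim -> 'rV[F v]_L;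
  cc_dec : {ffun 'I_L -> Y v} -> 'rV[F v]_cc_dim;
  cc_combine : forall xs : node n -> 'rV[F v]_cc_dim,
    \sum_(u | e u (Some v)) beta u v *: cc_enc u (xs u) =
    cc_word (\sum_(u | e u (Some v)) beta u v *: xs u);
  cc_isolated : ~~ [exists u, e u (Some v)] -> cc_dim = 0%N
}.

Arguments cc_enc {v L}.
Arguments cc_word {v L}.
Arguments cc_dec {v L}.

Definition cc_err v L (cc : comp_code v L) (x : 'rV[F v]_(cc_dim cc)) : R :=
  \sum_y (cc_dec cc y != x)%:R * block_chan (W v) (cc_word cc x) y.
Arguments cc_err {v L}.

Definition cc_good (delta eps : R) v L (cc : comp_code v L) : Prop :=
  ([exists u, e u (Some v)] ->
    expR (L%:R * (unif_info (W v) - delta)) <= #|{: 'rV[F v]_(cc_dim cc)}|%:R) /\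
  \sum_x cc_err cc x <= eps * #|{: 'rV[F v]_(cc_dim cc)}|%:R.

Lemma exists_comp_code (delta eps : R) v : 0 < delta -> 0 < eps ->
  exists L0, forall L, (L0 <= L)%N ->
    exists cc : comp_code v L, cc_good delta eps cc.
Proof.
move=> d0 e0; have [/existsP[u0 eu0]|iso] := boolP [exists u, e u (Some v)].
  have [L0 hL0] := affine_code (hdmc v) (hsym v) d0 e0.
  exists L0 => L /hL0[k [[G a] [dec [hk herr]]]].
  (* Only [u0] adds the offset, divided by its coefficient, so it enters the received sum exactly
     once. *)
  pose enc (u : node n) (x : 'rV[F v]_k) :=
    x *m G + (if u == u0 then (beta u0 v)^-1 *: a else 0).
  have comb (xs : node n -> 'rV[F v]_k) :
      \sum_(u | e u (Some v)) beta u v *: enc u (xs u) =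
      (\sum_(u | e u (Some v)) beta u v *: xs u) *m G + a.
    under eq_bigr do rewrite scalerDr scalemxAl.
    rewrite big_split/= -mulmx_suml; congr (_ + _).
    rewrite (bigD1 u0)//= eqxx big1 => [|u /andP[_ /negbTE ->]]; last first.
      by rewrite scaler0.
    by rewrite addr0 scalerA mulfV ?scale1r// hbeta.
  have iso' : ~~ [exists u, e u (Some v)] -> k = 0%N.
    by rewrite negb_exists => /forallP/(_ u0); rewrite eu0.
  by exists (@CompCode v L k enc (fun x => x *m G + a) dec comb iso'); split.
exists 0%N => L _.
have comb (xs : node n -> 'rV[F v]_0) :
    \sum_(u | e u (Some v)) beta u v *: (0 : 'rV[F v]_L) = 0.
  by rewrite big1// => u _; rewrite scaler0.
exists (@CompCode v L 0 (fun _ _ => 0) (fun=> 0) (fun=> 0) comb (fun=> erefl)).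
split; first by move=> /(elimN idP iso).
rewrite big1 => [|x _]; first by rewrite mulr_ge0// ltW.
by rewrite /cc_err big1// => y _; rewrite [x]thinmx0 eqxx mul0r.
Qed.

(** The marginal of an independent sequence on the times of one block. *)
Lemma sum_ffun_marginal (I J T : finType) (iota : J -> I) (w : I -> T -> R)
    (h : {ffun J -> T} -> R) :
  injective iota -> (forall i, \sum_x w i x = 1) ->
  \sum_(f : {ffun I -> T}) h [ffun j => f (iota j)] * \prod_i w i (f i) =
  \sum_g h g * \prod_j w (iota j) (g j).
Proof.
move=> iotaI w1.
rewrite (partition_big (fun f : {ffun I -> T} => [ffun j => f (iota j)]) predT)//=.
apply: eq_bigr => g _.
(* The sequences restricting to [g] form a product set: one symbol at times in the range of [iota],
   any symbol elsewhere. *)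
pose Q i := [pred x | [forall j, (iota j == i) ==> (x == g j)]].
transitivity (h g * \sum_(f in family Q) \prod_i w i (f i)).
  rewrite mulr_sumr; apply: eq_big => [f|f /eqP -> //].
  apply/eqP/familyP => [/ffunP fg i|fQ].
    by apply/forallP => j; apply/implyP => /eqP <-; rewrite -fg ffunE.
  apply/ffunP => j; rewrite ffunE; apply/eqP.
  by have /forallP/(_ j) := fQ (iota j); rewrite eqxx.
rewrite -bigA_distr_big_dep; congr (_ * _).
rewrite (bigID (fun i => i \in [set iota j | j in J]))/= mulrC big1 ?mul1r.
  rewrite big_imset/= => [|j j' _ _ /iotaI//]; apply: eq_bigr => j _.
  rewrite (big_pred1 (g j))// => x /=; apply/forallP/eqP => [/(_ j)|-> j'].
    by rewrite eqxx => /eqP.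
  by apply/implyP => /eqP/iotaI ->.
move=> i iN; rewrite -[RHS](w1 i); apply: eq_bigl => x /=.
apply/forallP => j; apply/implyP => /eqP ji.
by rewrite -ji imset_f in iN.
Qed.

(** * The block code and its error probability *)

Section Assembly.
Variables (N L B M' : nat).
Local Notation M := M'.+1.
Hypotheses (L0 : (0 < L)%N) (BLN : (B * L <= N)%N).
Variable cc : forall v, comp_code v L.
Local Notation k := (fun v => cc_dim (cc v)).
Variables (cb : nat -> {dffun forall v : 'I_n,
    {ffun state F k M B -> 'rV[F v]_(cc_dim (cc v))}}).
Variable X : history F k M B.
Hypothesis XE : forall v m (b : 'I_B), X v m b =
  combine e beta (cb b v) (state_of (fun v m => mask b (X v m))) m.

Lemma time_lt (b : 'I_B) (i : 'I_L) : (b * L + i < N)%N.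
Proof.
apply: leq_trans BLN; apply: (@leq_trans (b.+1 * L)%N).
  by rewrite mulSn addnC ltn_add2r.
by rewrite leq_mul2r ltn_ord orbT.
Qed.

Definition time (b : 'I_B) (i : 'I_L) : 'I_N := Ordinal (time_lt b i).
Definition phase (t : 'I_N) : 'I_L := Ordinal (ltn_pmod t L0).

Lemma time_div b i : (time b i %/ L = b)%N.
Proof. by rewrite /= divnMDl// divn_small// addn0. Qed.

Lemma time_phase b i : phase (time b i) = i.
Proof. by apply/val_inj; rewrite /= modnMDl modn_small. Qed.

Lemma time_inj b : injective (time b).
Proof. by move=> i i' /(congr1 phase); rewrite !time_phase. Qed.

Definition decoded v (y : {ffun 'I_N -> Y v}) : {ffun 'I_B -> 'rV[F v]_(k v)} :=
  [ffun b => cc_dec (cc v) [ffun i => y (time b i)]].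

(** Times left over after the [B] blocks carry 0. *)
Definition send v u (x : state F k M B) (t : 'I_N) : F v :=
  if (t %/ L < B)%N then cc_enc (cc v) u (cb (t %/ L) v x) 0 (phase t) else 0.

Definition block_src v (t : 'I_N) (m : 'I_M) : F v :=
  send v None (existT (state_type F k M B) None m) t.

Definition block_rly u v (t : 'I_N) (y : {ffun 'I_N -> Y u}) : F v :=
  send v (Some u)
    (existT (state_type F k M B) (Some u) (mask (t %/ L) (decoded y))) t.

(** Blocks kept by the mask end no later than the start [t %/ L * L] of the current block. *)
Lemma block_rly_causal u v (t : 'I_N) (y y' : {ffun 'I_N -> Y u}) :
  (forall i : 'I_N, (i < t)%N -> y i = y' i) ->
  block_rly v t y = block_rly v t y'.
Proof.
move=> yy'; rewrite /block_rly; congr (send v _ (existT _ _ _) t).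
apply/ffunP => b; rewrite !ffunE; case: ltnP => // bt; congr (cc_dec _ _).
apply/ffunP => i; rewrite !ffunE; apply: yy' => /=.
apply: (@leq_trans (b.+1 * L)%N); first by rewrite mulSn addnC ltn_add2r.
apply: (@leq_trans (t %/ L * L)%N); last exact: leq_divM.
by rewrite leq_mul2r bt orbT.
Qed.

Definition block_dec d (y : {ffun 'I_N -> Y d}) : 'I_M :=
  odflt ord0 [pick m | X d m == decoded y].

Definition block_code : code F Y N M :=
  Code block_src block_rly_causal block_dec.

(** The input of [v] if no node errs. It is free of the outputs, so [ideal_prob] is a product
    law. *)
Definition ideal_in v (t : 'I_N) (m : 'I_M) : F v :=
  if (t %/ L < B)%N then cc_word (cc v) (combine (k := k) e beta (cb (t %/ L) v)
    (state_of (fun v m => mask (t %/ L) (X v m))) m) 0 (phase t) else 0.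

Definition all_decoded m (y : traj Y N) : bool :=
  [forall v, decoded (y v) == X v m].

Lemma chan_in_ideal m y v t : all_decoded m y ->
  chan_in e beta block_code v t m y = ideal_in v t m.
Proof.
move=> /forallP good; rewrite /chan_in /ideal_in.
rewrite (eq_bigr (fun u => beta u v *
    send v u (state_of (fun v m => mask (t %/ L) (X v m)) u m) t)); last first.
  by move=> [u|] _ //=; rewrite /block_rly (eqP (good u)).
rewrite /send; case: ifP => _; last by rewrite big1// => u _; rewrite mulr0.
by rewrite -cc_combine summxE; apply: eq_bigr => u _; rewrite [RHS]mxE.
Qed.

Definition ideal_prob m (y : traj Y N) : R :=
  \prod_v \prod_t W v (ideal_in v t m) (y v t).

Lemma ideal_prob_ge0 m y : 0 <= ideal_prob m y.
Proof.
by apply: prodr_ge0 => v _; apply: prodr_ge0 => t _; exact: (hdmc v).1.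
Qed.

Lemma sum_ideal_prob m : \sum_y ideal_prob m y = 1.
Proof.
rewrite /ideal_prob (sum_traj_prod (fun v t b => W v (ideal_in v t m) b)).
by rewrite big1// => v _; rewrite big1// => t _; exact: (hdmc v).2.
Qed.

Lemma sum_ideal_block m v (b : 'I_B) :
  \sum_(y : traj Y N) (decoded (y v) b != X v m b)%:R * ideal_prob m y =
  cc_err (cc v) (X v m b).
Proof.
transitivity (\sum_(y : traj Y N) \prod_v' ((if v' == v then
    (decoded (y v') b != X v' m b)%:R else 1) *
    \prod_t W v' (ideal_in v' t m) (y v' t))).
  apply: eq_bigr => y _; rewrite big_split/=; congr (_ * _).
  by rewrite (bigD1 v)//= eqxx big1 ?mulr1// => v' /negbTE ->.
rewrite (sum_dffun_prod (fun v' (f : {ffun 'I_N -> Y v'}) => (if v' == v then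
    (decoded f b != X v' m b)%:R else 1) *
    \prod_t W v' (ideal_in v' t m) (f t))).
rewrite (bigD1 v)//= eqxx [X in _ * X]big1 ?mulr1; last first.
  move=> v' /negbTE ->; under eq_bigr do rewrite mul1r.
  rewrite -(bigA_distr_bigA (fun t x => W v' (ideal_in v' t m) x)).
  by rewrite big1// => t _; exact: (hdmc v').2.
under eq_bigr do rewrite ffunE.
rewrite (sum_ffun_marginal (iota := time b)
  (w := fun t x => W v (ideal_in v t m) x)
  (fun g => (cc_dec (cc v) g != X v m b)%:R) (@time_inj b)); last first.
  by move=> t; exact: (hdmc v).2.
apply: eq_bigr => g _; congr (_ * _); apply: eq_bigr => i _.
by rewrite /ideal_in time_div time_phase ltn_ord XE.
Qed.

(** The true and the ideal law agree where every block is decoded and both have mass 1, so the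
    complement has equal probability under both. The union bound is then taken under the ideal law,
    with no error propagation to follow. *)
Lemma sum_not_decoded m :
  \sum_y (~~ all_decoded m y)%:R * traj_prob W e beta block_code m y <=
  \sum_(b < B) \sum_v cc_err (cc v) (X v m b).
Proof.
have -> : \sum_y (~~ all_decoded m y)%:R * traj_prob W e beta block_code m y =
    \sum_y (~~ all_decoded m y)%:R * ideal_prob m y.
  have compl (p : traj Y N -> R) : \sum_y p y = 1 ->
      \sum_y (~~ all_decoded m y)%:R * p y =
      1 - \sum_y (all_decoded m y)%:R * p y.
    move=> p1; rewrite -[X in X - _]p1 -sumrB; apply: eq_bigr => y _.
    by case: (all_decoded m y); rewrite /= ?mul0r ?mul1r ?subrr ?subr0.
  rewrite !compl ?sum_ideal_prob ?sum_traj_prob//; congr (_ - _).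
  apply: eq_bigr => y _; case: (boolP (all_decoded m y)) => good; last by rewrite !mul0r.
  congr (_ * _); apply: eq_bigr => v _; apply: eq_bigr => t _.
  by rewrite chan_in_ideal.
apply: (@le_trans _ _ (\sum_y \sum_(b < B) \sum_v
    (decoded ((y : traj Y N) v) b != X v m b)%:R * ideal_prob m y)).
  apply: ler_sum => y _.
  under [leRHS]eq_bigr do rewrite -mulr_suml.
  rewrite -mulr_suml; apply: ler_wpM2r; first exact: ideal_prob_ge0.
  case: (boolP (all_decoded m y)) => [_|]; last first.
    rewrite negb_forall => /existsP[v]; case: eqP => // ne _.
    have [b bne] : exists b, decoded (y v) b != X v m b.
      apply/existsP; rewrite -negb_forall; apply/negP => /forallP h.
      by apply: ne; apply/ffunP => b; apply/eqP.
    rewrite (bigD1 b)//= (bigD1 v)//= bne -addrA lerDl addr_ge0//.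
      by apply: sumr_ge0 => v' _; exact: ler0n.
    by apply: sumr_ge0 => b' _; apply: sumr_ge0 => v' _; exact: ler0n.
  by apply: sumr_ge0 => b _; apply: sumr_ge0 => v _; exact: ler0n.
rewrite exchange_big/=; apply: ler_sum => b _; rewrite exchange_big/=.
by apply: ler_sum => v _; rewrite sum_ideal_block.
Qed.

(** If all blocks are decoded, a destination errs only when its records for two messages coincide;
    [pair_sum] counts these coincidences. *)
Lemma block_code_err :
  M%:R * err_prob W e beta D block_code <=
  pair_sum D (fun m m' d => (X d m == X d m')%:R) +
  \sum_(b < B) \sum_m \sum_v cc_err (cc v) (X v m b).
Proof.
rewrite /err_prob /pair_sum mulrA mulfV ?mul1r ?pnatr_eq0//.
rewrite [X in _ <= _ + X]exchange_big/= -big_split/=.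
apply: ler_sum => m _.
set conf := \sum_(m' | m' != m) _.
apply: le_trans (lerD (lexx conf) (sum_not_decoded m)).
rewrite -[X in X + _]mulr1 -[X in _ * X + _](sum_traj_prob e beta hdmc block_code m).
rewrite mulr_sumr -big_split/=; apply: ler_sum => y _.
have P0 : 0 <= traj_prob W e beta block_code m y.
  by apply: prodr_ge0 => v _; apply: prodr_ge0 => t _; exact: (hdmc v).1.
have in0 m' : 0 <= \sum_(d in D) (X d m == X d m')%:R :> R.
  by apply: sumr_ge0 => d _; exact: ler0n.
have conf0 : 0 <= conf by apply: sumr_ge0.
case: ifPn => [/existsP[d /andP[dD dne]]|_]; last first.
  by apply: addr_ge0; apply: mulr_ge0.
rewrite -mulrDl; apply: ler_peMl => //.
case: (boolP (all_decoded m y)) => [/forallP/(_ d)/eqP good|_]; last first.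
  by rewrite lerDr.
rewrite addr0; move: dne; rewrite /= /block_dec good.
case: pickP => [m1 /eqP m1E|/(_ m)]; last by rewrite eqxx.
move=> /= m1m; rewrite /conf (bigD1 m1)//= (bigD1 d)//= m1E eqxx -addrA lerDl.
by rewrite addr_ge0// ?sumr_ge0// => *; exact: ler0n.
Qed.

End Assembly.

Lemma exists_block_code (N L B M' : nat) (cc : forall v, comp_code v L)
    (delta eps a : R) :
  (0 < L)%N -> (B * L <= N)%N -> (forall v, cc_good delta eps (cc v)) ->
  0 < a -> a <= 1 ->
  (forall S : {set node n}, is_cut D S ->
    \prod_(v in cut_boundary e S) #|{: 'rV[F v]_(cc_dim (cc v))}|%:R^-1 <= a) ->
  exists c : code F Y N M'.+1, err_prob W e beta D c <=
    (a ^+ n)^-1 * (2 * a) ^+ B * (M'%:R * #|D|%:R) + B%:R * (n%:R * eps).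
Proof.
move=> L0 BLN good a0 a1 hcut.
have err0 v (x : 'rV[F v]_(cc_dim (cc v))) : 0 <= cc_err (cc v) x.
  apply: sumr_ge0 => y _; apply: mulr_ge0 => //.
  exact: (block_chan_ge0 (hdmc v)).
have [cb [X [XE hX]]] := @exists_relay_maps R n F e beta D hbeta
  (fun v => cc_dim (cc v)) M'.+1 B (fun v => cc_err (cc v)) eps a err0
  (fun v => (good v).2) (fun v => @cc_isolated v L (cc v)) a0 a1 hcut.
exists (block_code L0 BLN cb X).
have M0 : 0 < M'.+1%:R :> R by rewrite ltr0n.
rewrite -(ler_pM2l M0); apply: le_trans (block_code_err L0 BLN XE) _.
apply: le_trans hX _; rewrite le_eqVlt; apply/orP; left; apply/eqP.
by rewrite -natr1; ring.
Qed.

(** A single message suffices; this also makes the set of achievable rates nonempty. *)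
Lemma achievable_neg (r : R) : r < 0 -> achievable W e beta D r.
Proof.
move=> r0 eps e0; exists 0%N => N _; exists 1%N.
pose c : code F Y N 1 := @Code n F Y N 1 (fun _ _ _ => 0) (fun _ _ _ _ => 0)
  (fun _ _ _ _ _ _ => erefl) (fun _ _ => ord0).
exists c; split.
  rewrite powR2E -[leRHS]expR0 ler_expR -mulrA mulr_ge0_le0//.
  by rewrite mulr_le0_ge0 ?ltW// ln2_gt0.
rewrite /err_prob big1 ?mulr0 ?ltW// => m _; rewrite big1// => y _.
by case: ifP => // /existsP[d /andP[_]]; rewrite [m]ord1 eqxx.
Qed.

(** [B] is fixed first, so large that [a ^ B] beats both the loss [(a ^ n)^-1] and the number of
    messages; then the block length grows with [N]. *)
Lemma achievable_lt_cut (r rate : R) : 0 <= r -> r * ln 2 < rate ->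
  (forall S : {set node n}, is_cut D S ->
    rate <= \sum_(v in cut_boundary e S) unif_info (W v)) ->
  achievable W e beta D r.
Proof.
move=> r0 rlt hcut eps e0; set rho := r * ln 2 in rlt.
have rho0 : 0 <= rho by rewrite mulr_ge0// ltW// ln2_gt0.
(* [c1] is the exponent in [a]; [delta] is chosen so that the at most [n] boundary nodes lose at
   most [rate - c1] together. *)
pose c1 := (rate + rho) / 2; have c1rho : 0 < c1 - rho by rewrite /c1; lra.
have c10 : 0 < c1 by lra.
pose delta := (rate - rho) / 2 / n.+1%:R.
have d0 : 0 < delta by rewrite !divr_gt0 ?ltr0n// subr_gt0.
pose B := (Num.truncn (n%:R * c1 / (c1 - rho))).+1.
have B0 : 0 < B%:R :> R by rewrite ltr0n.
pose kappa := B%:R * c1 - n%:R * c1 - B%:R * rho.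
have kappa0 : 0 < kappa.
  have : n%:R * c1 / (c1 - rho) < B%:R by exact: truncnS_gt.
  by rewrite ltr_pdivrMr// /kappa; lra.
pose eps' := eps / 2 / (B%:R * n.+1%:R).
have eps'0 : 0 < eps' by rewrite !divr_gt0// mulr_gt0// ltr0n.
have [L1 hL1] := common_nat (fun v => exists_comp_code v d0 eps'0).
(* [n.+1] bounds the number of destinations and [2 ^ B] comes from [(2 a) ^ B]; the term [B rho]
   below pays for rounding [N] to a multiple of [B]. *)
pose K : R := n.+1%:R * 2 ^+ B.
have K0 : 0 < K by rewrite mulr_gt0 ?ltr0n ?exprn_gt0.
have [L2 hL2] := expR_decay (ln K + B%:R * rho) kappa0 (divr_gt0 e0 (ltr0Sn R 1)).
pose L0 := (maxn 1 (maxn L1 L2)); exists (L0 * B)%N => N hN.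
pose L := (N %/ B)%N.
have : (L0 <= L)%N by rewrite leq_divRL.
rewrite /L0 !geq_max => /and3P[Lpos /hL1{}hL1 /hL2{}hL2].
have [cc hcc] := fin_all_exists hL1.
have BLN : (B * L <= N)%N by rewrite mulnC leq_divM.
(* With [M'.+1] messages the count exceeds [exp (N rho) = 2 ^ (N r)]. *)
pose M' := Num.truncn (expR (N%:R * rho)).
pose a := expR (- (L%:R * c1)).
have a0 : 0 < a by exact: expR_gt0.
have a1 : a <= 1 by rewrite -expR0 ler_expR oppr_le0 mulr_ge0// ltW.
have acut (S : {set node n}) : is_cut D S ->
    \prod_(v in cut_boundary e S) #|{: 'rV[F v]_(cc_dim (cc v))}|%:R^-1 <= a.
  move=> Scut; set Bd := cut_boundary e S.
  apply: (@le_trans _ _ (\prod_(v in Bd) expR (- (L%:R * (unif_info (W v) - delta))))).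
    apply: ler_prod => v vBd; rewrite invr_ge0 ler0n/= expRN lef_pV2 ?posrE ?expR_gt0//.
      apply: (hcc v).1; move: vBd; rewrite inE => /andP[_ /existsP[u /andP[_ eu]]].
      by apply/existsP; exists u.
    by rewrite ltr0n; apply/card_gt0P; exists 0.
  rewrite -expR_sum ler_expR sumrN lerN2 -mulr_sumr; apply: ler_wpM2l => //.
  rewrite sumrB sumr_const -(mulr_natl delta).
  have cB : #|Bd|%:R * delta <= n.+1%:R * delta.
    apply: ler_wpM2r; first exact: ltW.
    by rewrite ler_nat ltnW// ltnS -[leqRHS]card_ord max_card.
  have nd : n.+1%:R * delta = (rate - rho) / 2.
    by rewrite /delta mulrC mulfVK// pnatr_eq0.
  have := hcut S Scut; rewrite -/Bd /c1; lra.
have [c hc] := exists_block_code M' Lpos BLN hcc a0 a1 acut.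
exists M'.+1, c; split.
  by rewrite powR2E -mulrA ltW// truncnS_gt.
apply: le_trans hc _.
have -> : eps = eps / 2 + eps / 2 by field.
apply: lerD; last first.
  rewrite [leLHS](_ : _ = n%:R / n.+1%:R * (eps / 2)); last first.
    rewrite /eps'; have : n.+1%:R != 0 :> R by rewrite pnatr_eq0.
    move: (n.+1%:R) => n1 n10; field; rewrite n10/=.
    by rewrite gt_eqF.
  rewrite -[leRHS]mul1r; apply: ler_wpM2r; first by rewrite divr_ge0// ltW.
  by rewrite ler_pdivrMr ?ltr0n// mul1r ler_nat.
apply: le_trans hL2.
have M'le : M'%:R <= expR (N%:R * rho) by rewrite truncn_le expR_ge0.
have Dle : #|D|%:R <= n.+1%:R :> R.
  by rewrite ler_nat ltnW// ltnS -[leqRHS]card_ord max_card.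
apply: (@le_trans _ _ ((a ^+ n)^-1 * (2 * a) ^+ B * (expR (N%:R * rho) * n.+1%:R))).
  apply: ler_wpM2l; last by apply: ler_pM.
  by rewrite mulr_ge0 ?invr_ge0 ?exprn_ge0 ?mulr_ge0// ltW.
have NL : N%:R * rho <= (L%:R + 1) * B%:R * rho.
  apply: ler_wpM2r => //; rewrite natr1 -natrM ler_nat.
  by rewrite mulSn addnC ltnW// {1}(divn_eq N B) ltn_add2l ltn_pmod.
rewrite exprMn /a -!expRM_natl -expRN.
have ringE (x y z p q : R) : x * (p * y) * (z * q) = q * p * (x * y * z) by ring.
rewrite ringE -/K.
rewrite -!expRD -[X in X * _]lnK ?posrE// -expRD ler_expR /kappa.
by move: NL; lra.
Qed.

End BlockCode.

(** * Matching the two bounds *)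

Unset Implicit Arguments.

Theorem theorem4 (R : realType) (n : nat)
  (F : 'I_n -> finFieldType) (Y : 'I_n -> finType)
  (W : forall v : 'I_n, F v -> Y v -> R)
  (e : rel (node n)) (beta : forall (u : node n) (v : 'I_n), F v)
  (D : {set 'I_n})
  (hsrc : forall u : node n, ~~ e u None)
  (hdest : forall d, d \in D -> forall w : node n, ~~ e (Some d) w)
  (hD : exists d : 'I_n, d \in D)
  (hbeta : forall (u : node n) (v : 'I_n), e u (Some v) -> beta u v != 0)
  (hdmc : forall v : 'I_n, is_dmc (W v))
  (hsym : forall v : 'I_n, gallager_symmetric (W v)) :
  multicast_capacity W e beta D = min_cut W e D.
Proof.
have ln20 := ln2_gt0 R.
have cutE S : cut_value W e S * ln 2 =
    \sum_(v in cut_boundary e S) unif_info (W v).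
  rewrite /cut_value mulr_suml; apply: eq_bigr => v _.
  exact: (capacityE (0 : F v) (hdmc v) (hsym v)).
have cut0 : is_cut D [set None].
  rewrite /is_cut inE eqxx/=; have [d dD] := hD.
  by apply/existsP; exists d; rewrite dD inE.
have min_le S : is_cut D S -> min_cut W e D <= cut_value W e S.
  move=> Scut; apply: ge_inf; last by exists S.
  (* Nonnegative capacities bound the cut values below, so the infimum lies under each of them. *)
  exists 0 => _ [S' [_ ->]]; rewrite -(pmulr_lge0 _ ln20) cutE.
  by apply: sumr_ge0 => v _; exact: (unif_info_ge0 (0 : F v) (hdmc v) (hsym v)).
have ach_le r : achievable W e beta D r -> r <= min_cut W e D.
  move=> ach; apply: lb_le_inf; first by exists (cut_value W e [set None]), [set None].
  move=> _ [S [Scut ->]]; rewrite -(ler_pM2r ln20) cutE.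
  exact: (achievable_le_cut hdmc hsym ach).
have lt_ach r : r < min_cut W e D -> achievable W e beta D r.
  move=> rlt; have [r0|r0] := leP 0 r; last exact: achievable_neg.
  apply: (@achievable_lt_cut _ _ _ _ _ _ _ _ hbeta hdmc hsym _
    (min_cut W e D * ln 2)) => // [|S Scut]; first by rewrite ltr_pM2r.
  by rewrite -cutE ler_pM2r// min_le.
apply: le_anti; apply/andP; split.
  by apply: ge_sup => //; exists (-1); apply: achievable_neg; rewrite ltrN10.
rewrite leNgt; apply/negP => lt_min.
(* Achievability is known strictly below the minimum cut, hence the midpoint. *)
have [r_gt r_lt] := midf_lt lt_min; set r := (_ + _) / 2 in r_gt r_lt.
move: r_gt; rewrite ltNge => /negP; apply; apply: ub_le_sup.
  by exists (min_cut W e D).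
exact: lt_ach.
Qed.
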